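(* Let $\{F_i\}_{i\in\mathcal{I}}$ be a differential factorization inverse system over a differential field $F$ with the simultaneous factorization property, and let $K=C_F$ be the field of constants of $F$. Let $G$ be a linear algebraic group over $K$, and let $(\{S_i\}_{i\in\mathcal{I}},\{\Theta_{kl_k},\Theta_{kr_k}\}_{k\in\mathcal{I}_e})$ define a patching problem of differential $G_F$-torsors. Then, up to differential isomorphism, there exists a unique solution $(S,\{\Phi_i\}_{i\in\mathcal{I}_v})$. It is given by the inverse limit $S=\varprojlim_{i\in\mathcal{I}} S_i$ (with respect to the maps $S_i\to F_k\otimes_{F_i}S_i\xrightarrow{\Theta_{ki}}S_k$), with $\Phi_i\colon F_i\otimes_F S\to S_i$ induced by the natural map $S\to S_i$, and with the $G$-action and the derivation on $S$ given by restriction from those on the rings $S_i$.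
   Context: Factorization inverse systems. A factorization inverse system over a field $F$ is a finite inverse system of fields $\{F_i\}_{i\in\mathcal{I}}$ whose inverse limit (in the category of rings) is $F$, whose index set is a disjoint union $\mathcal{I}=\mathcal{I}_v\cup\mathcal{I}_e$ such that for each $k\in\mathcal{I}_e$ there are exactly two elements $i,j\in\mathcal{I}_v$ for which the system contains maps $F_i,F_j\to F_k$, and such that there are no other maps in the system. Write $i\succ k$ if there is a map $F_i\to F_k$. For every $k\in\mathcal{I}_e$ one fixes a labeling $l_k,r_k\in\mathcal{I}_v$ of the two elements $\succ k$. The system has the simultaneous factorization property if for every $n\geq 1$ and any collection of matrices $A_k\in\mathrm{GL}_n(F_k)$, $k\in\mathcal{I}_e$, there exist $A_i\in\mathrm{GL}_n(F_i)$ for $i\in\mathcal{I}_v$ such that $A_k=A_{r_k}^{-1}A_{l_k}$ in $\mathrm{GL}_n(F_k)$ for all $k\in\mathcal{I}_e$. A differential factorization inverse system is one where all $F_i$ are differential fields of characteristic zero and all inclusions $F_{l_k},F_{r_k}\hookrightarrow F_k$ are differential homomorphisms; then $F$ inherits the structure of a differential field. Differential torsors. A linear algebraic group over $K$ is an affine group scheme of finite type over $K$. For a differential field extension $L/F$, $L[G]:=L\otimes_K K[G]$ is a differential ring in which the elements of $K[G]$ are constant. A $G_L$-torsor is a non-empty affine scheme $X$ of finite type over $L$ with a right $G_L$-action such that for every $L$-algebra $R$ and all $x,y\in X(R)$ there is a unique $g\in G(R)$ with $y=x.g$. A differential $G_L$-torsor is a $G_L$-torsor $X$ together with an extension of the derivation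 from $L$ to $L[X]$ such that the co-action $\rho\colon L[X]\to L[X]\otimes_L L[G]$ is a differential homomorphism. Morphisms are equivariant morphisms whose dual maps are differential. Patching problems. A patching problem of differential $G_F$-torsors consists of differential $G_{F_i}$-torsors $X_i=\mathrm{Spec}(S_i)$ for $i\in\mathcal{I}$ together with, for all $i\succ k$, isomorphisms $\Theta_{ki}\colon F_k\otimes_{F_i}S_i\to S_k$ of differential $F_k$-algebras respecting the $G$-actions (i.e. corresponding to isomorphisms of differential $G_{F_k}$-torsors). A solution is a differential $G_F$-torsor $\mathrm{Spec}(S)$ together with isomorphisms $\Phi_i\colon F_i\otimes_F S\to S_i$, $i\in\mathcal{I}_v$, corresponding to isomorphisms of differential $G_{F_i}$-torsors, such that for each $k\in\mathcal{I}_e$ the two maps $\Theta_{kl_k}\circ(\mathrm{id}_{F_k}\otimes_{F_{l_k}}\Phi_{l_k})$ and $\Theta_{kr_k}\circ(\mathrm{id}_{F_k}\otimes_{F_{r_k}}\Phi_{r_k})\colon F_k\otimes_F S\to S_k$ coincide. *)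

(* Defs.v *)
From HB Require Import structures.
From mathcomp Require Import all_boot all_algebra generic_quotient.
From mathcomp Require Import boolp.

Set Implicit Arguments.
Unset Strict Implicit.
Unset Printing Implicit Defensive.

Import GRing.Theory.
Local Open Scope ring_scope.
Local Open Scope quotient_scope.

(* Rings are commutative and possibly zero (comPzRingType): R-points of a
   scheme are taken in all of them.  An L-algebra is a ring A together with
   its structure map L -> A. *)

Section TensorRel.
Context {L : Type} {A B : comPzRingType}.
Variables (f : L -> A) (g : L -> B).

(* The sequence [:: (a1, b1); ..; (an, bn)] stands for the formal sum
   a1 (x) b1 + .. + an (x) bn. *)
Inductive tens_rel : seq (A * B) -> seq (A * B) -> Prop :=
| TRrefl s : tens_rel s s
| TRsym s t : tens_rel s t -> tens_rel t s
| TRtrans s t u : tens_rel s t -> tens_rel t u -> tens_rel s u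
| TRcat s t s' t' :
    tens_rel s s' -> tens_rel t t' -> tens_rel (s ++ t) (s' ++ t')
| TRcatC s t : tens_rel (s ++ t) (t ++ s)
| TR0l b : tens_rel [:: (0, b)] [::]
| TR0r a : tens_rel [:: (a, 0)] [::]
| TRDl a a' b : tens_rel [:: (a + a', b)] [:: (a, b); (a', b)]
| TRDr a b b' : tens_rel [:: (a, b + b')] [:: (a, b); (a, b')]
| TRbal a l b : tens_rel [:: (a * f l, b)] [:: (a, g l * b)].

Definition tens_relb (s t : seq (A * B)) : bool := `[< tens_rel s t >].

Lemma tens_relb_refl : reflexive tens_relb.
Proof. by move=> s; apply/asboolP/TRrefl. Qed.
Lemma tens_relb_sym : symmetric tens_relb.
Proof. by move=> s t; apply/asboolP/asboolP; apply: TRsym. Qed.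
Lemma tens_relb_trans : transitive tens_relb.
Proof. by move=> s t u /asboolP H /asboolP H'; apply/asboolP/(TRtrans H). Qed.

Canonical tens_equiv :=
  EquivRel tens_relb tens_relb_refl tens_relb_sym tens_relb_trans.

(* A (x)_L B, where f : L -> A and g : L -> B are the structure maps. *)
Definition tensor : Type := {eq_quot tens_equiv}.
HB.instance Definition _ := Choice.on tensor.

Definition tcls (s : seq (A * B)) : tensor := \pi_({eq_quot tens_equiv}) s.
Definition trep (x : tensor) : seq (A * B) := repr x.

Lemma trepK x : tcls (trep x) = x. Proof. exact: reprK. Qed.

Lemma tclsP s t : tcls s = tcls t <-> tens_rel s t.
Proof.
have E := @eqmodP _ tens_equiv s t.
by split=> [H|/asboolP H]; [apply/asboolP; apply/E|apply/E].
Qed.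

Lemma trep_cls s : tens_rel (trep (tcls s)) s.
Proof. by apply/tclsP; rewrite trepK. Qed.

Definition tadd (x y : tensor) := tcls (trep x ++ trep y).
Definition topp (x : tensor) := tcls [seq (- p.1, p.2) | p <- trep x].

Lemma tadd_cls s t : tadd (tcls s) (tcls t) = tcls (s ++ t).
Proof. by apply/tclsP/TRcat; apply: trep_cls. Qed.

Lemma taddA : associative tadd.
Proof.
by move=> x y z; rewrite -(trepK x) -(trepK y) -(trepK z) !tadd_cls catA.
Qed.
Lemma taddC : commutative tadd.
Proof.
by move=> x y; rewrite -(trepK x) -(trepK y) !tadd_cls; apply/tclsP/TRcatC.
Qed.
Lemma tadd0 : left_id (tcls [::]) tadd.
Proof. by move=> x; rewrite -(trepK x) tadd_cls. Qed.

Lemma taddNs s : tadd (tcls [seq (- p.1, p.2) | p <- s]) (tcls s) = tcls [::].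
Proof.
elim: s => [|[a b] s IH] /=; first by rewrite tadd_cls.
rewrite -cat1s -[in X in tadd _ X](cat1s (a, b) s) -!tadd_cls.
rewrite taddA (taddC _ (tcls [:: (a, b)])) !taddA -taddA IH tadd_cls.
rewrite taddC tadd0; apply/tclsP; apply: TRtrans (TR0l b).
by apply: TRtrans (TRsym (TRDl a (- a) b)) _; rewrite subrr; apply: TRrefl.
Qed.

Lemma taddN : left_inverse (tcls [::]) topp tadd.
Proof. by move=> x; rewrite -[in X in tadd _ X](trepK x) taddNs. Qed.

HB.instance Definition _ := GRing.isZmodule.Build tensor taddA taddC tadd0 taddN.

Definition tens (a : A) (b : B) : tensor := tcls [:: (a, b)].

Lemma tcls_sum s : tcls s = \sum_(p <- s) tens p.1 p.2.
Proof.
elim: s => [|[a b] s IH]; first by rewrite big_nil.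
by rewrite big_cons -IH -cat1s -tadd_cls.
Qed.

Lemma tens_repE x : x = \sum_(p <- trep x) tens p.1 p.2.
Proof. by rewrite -tcls_sum trepK. Qed.

Lemma tensDl a a' b : tens (a + a') b = tens a b + tens a' b.
Proof. by rewrite [RHS]tadd_cls; apply/tclsP; apply: TRDl. Qed.
Lemma tensDr a b b' : tens a (b + b') = tens a b + tens a b'.
Proof. by rewrite [RHS]tadd_cls; apply/tclsP; apply: TRDr. Qed.
Lemma tens0l b : tens 0 b = 0. Proof. by apply/tclsP; apply: TR0l. Qed.
Lemma tens0r a : tens a 0 = 0. Proof. by apply/tclsP; apply: TR0r. Qed.
Lemma tens_bal a l b : tens (a * f l) b = tens a (g l * b).
Proof. by apply/tclsP; apply: TRbal. Qed.

Lemma tens_ind (P : tensor -> Prop) :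
  P 0 -> (forall x y, P x -> P y -> P (x + y)) -> (forall a b, P (tens a b)) ->
  forall x, P x.
Proof. by move=> P0 PD Pt x; rewrite (tens_repE x); elim/big_ind: _. Qed.

(* The additive map a (x) b |-> h a b induced by h : A -> B -> M; meaningful
   when h is biadditive and balanced over L. *)
Definition tbil (M : zmodType) (h : A -> B -> M) (x : tensor) : M :=
  \sum_(p <- trep x) h p.1 p.2.

Definition balanced (M : zmodType) (h : A -> B -> M) : Prop :=
  [/\ forall a a' b, h (a + a') b = h a b + h a' b,
      forall a b b', h a (b + b') = h a b + h a b' &
      forall a l b, h (a * f l) b = h a (g l * b)].

Section Bil.
Variables (M : zmodType) (h : A -> B -> M) (hP : balanced h).

Lemma tbil_rel s t : tens_rel s t ->
  \sum_(p <- s) h p.1 p.2 = \sum_(p <- t) h p.1 p.2.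
Proof.
have [hDl hDr hb] := hP.
have h0l b : h 0 b = 0 by apply: (addrI (h 0 b)); rewrite -hDl !addr0.
have h0r a : h a 0 = 0 by apply: (addrI (h a 0)); rewrite -hDr !addr0.
elim=> {s t} [//|s t _ ->//|s t u _ -> _ ->//|s t s' t' _ E _ E'|s t|b|a
             |a a' b|a b b'|a l b]; rewrite ?big_cat ?big_cons ?big_nil /=.
- by rewrite E E'.
- exact: addrC.
- by rewrite h0l addr0.
- by rewrite h0r addr0.
- by rewrite hDl !addr0.
- by rewrite hDr !addr0.
- by rewrite hb.
Qed.

Lemma tbilE a b : tbil h (tens a b) = h a b.
Proof. by rewrite /tbil (tbil_rel (trep_cls _)) big_seq1. Qed.

Lemma tbilD : {morph tbil h : x y / x + y}.
Proof.
move=> x y; rewrite -[in LHS](trepK x) -[in LHS](trepK y) [X in tbil h X]tadd_cls.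
by rewrite /tbil (tbil_rel (trep_cls _)) big_cat.
Qed.

Lemma tbil0 : tbil h 0 = 0.
Proof. by apply: (addrI (tbil h 0)); rewrite -tbilD !addr0. Qed.
End Bil.

Lemma tmul_bal1 a b : balanced (fun a' b' => tens (a * a') (b * b')).
Proof.
split=> [x y z|x y z|x l z]; rewrite ?mulrDr ?tensDl ?tensDr //.
by rewrite mulrA tens_bal mulrCA.
Qed.

Definition tmul (x y : tensor) : tensor :=
  tbil (fun a b => tbil (fun a' b' => tens (a * a') (b * b')) y) x.

Lemma tmul_bal2 y :
  balanced (fun a b => tbil (fun a' b' => tens (a * a') (b * b')) y).
Proof.
split=> [a a' b|a b b'|a l b].
- elim/tens_ind: y => [|y z Hy Hz|c d]; first by rewrite !(tbil0 (tmul_bal1 _ _)) addr0.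
    by rewrite !(tbilD (tmul_bal1 _ _)) Hy Hz addrACA.
  by rewrite !(tbilE (tmul_bal1 _ _)) mulrDl tensDl.
- elim/tens_ind: y => [|y z Hy Hz|c d]; first by rewrite !(tbil0 (tmul_bal1 _ _)) addr0.
    by rewrite !(tbilD (tmul_bal1 _ _)) Hy Hz addrACA.
  by rewrite !(tbilE (tmul_bal1 _ _)) mulrDl tensDr.
- elim/tens_ind: y => [|y z Hy Hz|c d]; first by rewrite !(tbil0 (tmul_bal1 _ _)).
    by rewrite !(tbilD (tmul_bal1 _ _)) Hy Hz.
  by rewrite !(tbilE (tmul_bal1 _ _)) mulrAC tens_bal mulrA.
Qed.

Lemma tmulE a b a' b' : tmul (tens a b) (tens a' b') = tens (a * a') (b * b').
Proof. by rewrite /tmul (tbilE (tmul_bal2 _)) (tbilE (tmul_bal1 _ _)). Qed.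

Lemma tmulDl : left_distributive tmul +%R.
Proof. by move=> x y z; rewrite /tmul (tbilD (tmul_bal2 _)). Qed.
Lemma tmul0l x : tmul 0 x = 0.
Proof. by rewrite /tmul (tbil0 (tmul_bal2 _)). Qed.

Lemma tmulDr x y z : tmul x (y + z) = tmul x y + tmul x z.
Proof.
elim/tens_ind: x => [|x x' IH IH'|a b]; first by rewrite !tmul0l addr0.
  by rewrite !tmulDl IH IH' addrACA.
by rewrite /tmul !(tbilE (tmul_bal2 _)) (tbilD (tmul_bal1 _ _)).
Qed.
Lemma tmul0r x : tmul x 0 = 0.
Proof. by apply: (addrI (tmul x 0)); rewrite -tmulDr !addr0. Qed.

Lemma tmulC : commutative tmul.
Proof.
move=> x y; elim/tens_ind: x => [|x x' IH IH'|a b].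
- by rewrite tmul0l tmul0r.
- by rewrite tmulDl tmulDr IH IH'.
elim/tens_ind: y => [|y y' IH IH'|a' b'].
- by rewrite tmul0l tmul0r.
- by rewrite tmulDl tmulDr IH IH'.
by rewrite !tmulE mulrC (mulrC b).
Qed.

Lemma tmulA : associative tmul.
Proof.
move=> x y z; elim/tens_ind: x => [|x x' IH IH'|a b].
- by rewrite !tmul0l.
- by rewrite !tmulDl IH IH'.
elim/tens_ind: y => [|y y' IH IH'|a' b'].
- by rewrite !(tmul0l, tmul0r).
- by rewrite !(tmulDl, tmulDr) IH IH'.
elim/tens_ind: z => [|z z' IH IH'|a'' b''].
- by rewrite !(tmul0l, tmul0r).
- by rewrite !(tmulDl, tmulDr) IH IH'.
by rewrite !tmulE !mulrA.
Qed.

Lemma tmul1 : left_id (tens 1 1) tmul.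
Proof.
elim/tens_ind=> [|x y IH IH'|a b]; first exact: tmul0r.
  by rewrite tmulDr IH IH'.
by rewrite tmulE !mul1r.
Qed.

HB.instance Definition _ :=
  GRing.Zmodule_isComPzRing.Build tensor tmulA tmulC tmul1 tmulDl.

Lemma tensM a b a' b' : tens a b * tens a' b' = tens (a * a') (b * b').
Proof. exact: tmulE. Qed.

Lemma tens_split a b : tens a b = tens a 1 * tens 1 b.
Proof. by rewrite tensM mulr1 mul1r. Qed.

Lemma tensNl a b : tens (- a) b = - tens a b.
Proof. by apply: (addrI (tens a b)); rewrite -tensDl !subrr tens0l. Qed.
Lemma tensNr a b : tens a (- b) = - tens a b.
Proof. by apply: (addrI (tens a b)); rewrite -tensDr !subrr tens0r. Qed.

Definition tinl (a : A) : tensor := tens a 1.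
Definition tinr (b : B) : tensor := tens 1 b.

Lemma tinl_zmod : zmod_morphism tinl.
Proof. by move=> a b; rewrite /tinl tensDl tensNl. Qed.
Lemma tinl_monoid : monoid_morphism tinl.
Proof. by split=> // a b; rewrite /tinl tensM mulr1. Qed.
HB.instance Definition _ := GRing.isZmodMorphism.Build A tensor tinl tinl_zmod.
HB.instance Definition _ :=
  GRing.isMonoidMorphism.Build A tensor tinl tinl_monoid.

Lemma tinr_zmod : zmod_morphism tinr.
Proof. by move=> a b; rewrite /tinr tensDr tensNr. Qed.
Lemma tinr_monoid : monoid_morphism tinr.
Proof. by split=> // a b; rewrite /tinr tensM mulr1. Qed.
HB.instance Definition _ := GRing.isZmodMorphism.Build B tensor tinr tinr_zmod.
HB.instance Definition _ :=
  GRing.isMonoidMorphism.Build B tensor tinr tinr_monoid.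

Lemma tinlr l : tinl (f l) = tinr (g l).
Proof. by rewrite /tinl -[f l]mul1r tens_bal mulr1. Qed.

End TensorRel.

(* The homomorphism A (x)_L B -> T, a (x) b |-> u a * v b. *)
Definition tlift {L : Type} {A B T : comPzRingType} {f : L -> A} {g : L -> B}
    (u : A -> T) (v : B -> T) : tensor f g -> T :=
  tbil (fun a b => u a * v b).

(* The homomorphism A (x)_L B -> A' (x)_L' B', a (x) b |-> u a (x) v b. *)
Definition tmap {L L' : Type} {A B A' B' : comPzRingType}
    {f : L -> A} {g : L -> B} {f' : L' -> A'} {g' : L' -> B'}
    (u : A -> A') (v : B -> B') : tensor f g -> tensor f' g' :=
  tlift (tinl f' g' \o u) (tinr f' g' \o v).

Section Lift.
Context {L : Type} {A B T : comPzRingType} {f : L -> A} {g : L -> B}.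
Variables (u : {rmorphism A -> T}) (v : {rmorphism B -> T}).
Hypothesis uv : forall l, u (f l) = v (g l).

Lemma tlift_bal : balanced f g (fun a b => u a * v b).
Proof.
split=> [a a' b|a b b'|a l b]; rewrite ?rmorphD ?mulrDl ?mulrDr //.
by rewrite !rmorphM uv mulrA.
Qed.

Lemma tliftE a b : tlift u v (tens f g a b) = u a * v b.
Proof. exact: (tbilE tlift_bal). Qed.

Lemma tlift_inl a : tlift u v (tinl f g a) = u a.
Proof. by rewrite /tinl tliftE rmorph1 mulr1. Qed.

Lemma tlift_inr b : tlift u v (tinr f g b) = v b.
Proof. by rewrite /tinr tliftE rmorph1 mul1r. Qed.

Lemma tlift_zmod : zmod_morphism (tlift u v : tensor f g -> T).
Proof.
move=> x y; apply/eqP; rewrite eq_sym subr_eq -(tbilD tlift_bal).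
by rewrite subrK.
Qed.

Lemma tlift_monoid : monoid_morphism (tlift u v : tensor f g -> T).
Proof.
have D := tbilD tlift_bal; have Z := tbil0 tlift_bal.
split=> [|x y]; first by rewrite tliftE !rmorph1 mulr1.
elim/(@tens_ind _ _ _ f g): x => [|x x' IH IH'|a b]; first by rewrite mul0r /tlift Z mul0r.
  by rewrite mulrDl /tlift !D mulrDl -IH -IH'.
elim/(@tens_ind _ _ _ f g): y => [|y y' IH IH'|a' b']; first by rewrite mulr0 /tlift Z mulr0.
  by rewrite mulrDr /tlift !D mulrDr -IH -IH'.
by rewrite tensM !tliftE !rmorphM mulrACA.
Qed.

Lemma tlift_rmorph :
  {h : {rmorphism tensor f g -> T} | h =1 (tlift u v : tensor f g -> T)}.
Proof.
pose Mz := GRing.isZmodMorphism.Build _ _ _ tlift_zmod.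
pose Mm := GRing.isMonoidMorphism.Build _ _ _ tlift_monoid.
pose h : GRing.RMorphism.type _ _ := HB.pack (tlift u v : tensor f g -> T) Mz Mm.
by exists h.
Qed.
End Lift.

Section Map.
Context {L L' : Type} {A B A' B' : comPzRingType}
  {f : L -> A} {g : L -> B} {f' : L' -> A'} {g' : L' -> B'}.
Variables (u : {rmorphism A -> A'}) (v : {rmorphism B -> B'}) (w : L -> L').
Hypotheses (uE : forall l, u (f l) = f' (w l)) (vE : forall l, v (g l) = g' (w l)).

Lemma tmap_compat l : (tinl f' g' \o u) (f l) = (tinr f' g' \o v) (g l).
Proof. by rewrite /= uE vE tinlr. Qed.

Lemma tmapE a b : tmap u v (tens f g a b) = tens f' g' (u a) (v b).
Proof. by rewrite /tmap (tliftE tmap_compat) tensM mulr1 mul1r. Qed.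
End Map.

(* Two homomorphisms on a tensor product agree if they do on both factors. *)
Lemma tens_eq_hom {L : Type} {A B T : comPzRingType} {f : L -> A} {g : L -> B}
    (u v : {rmorphism tensor f g -> T}) :
  (forall a, u (tinl f g a) = v (tinl f g a)) ->
  (forall b, u (tinr f g b) = v (tinr f g b)) -> u =1 v.
Proof.
move=> Hl Hr; elim/(@tens_ind _ _ _ f g)=> [|x y IH IH'|a b]; first by rewrite !rmorph0.
  by rewrite !rmorphD IH IH'.
by rewrite tens_split !rmorphM [u _]Hl [u _]Hr.
Qed.

HB.mixin Record isDiffRing R of GRing.ComPzRing R := {
  der : R -> R;
  derD : {morph der : x y / x + y};
  derM : forall x y, der (x * y) = der x * y + x * der y
}.
#[short(type="diffRingType")]
HB.structure Definition DiffRing := {R of isDiffRing R & GRing.ComPzRing R}.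
#[short(type="diffFieldType")]
HB.structure Definition DiffField := {R of isDiffRing R & GRing.Field R}.

HB.mixin Record isDiffMorphism (A B : diffRingType) (f : A -> B) := {
  dmorph_der : forall x, f (der x) = der (f x)
}.
HB.structure Definition DiffMorphism (A B : diffRingType) :=
  {f of @isDiffMorphism A B f & @GRing.RMorphism A B f}.
Notation "{ 'dmorphism' A '->' B }" := (DiffMorphism.type A B)
  (A at level 98, B at level 99, format "{ 'dmorphism'  A  ->  B }").

Section DiffRingTheory.
Variable R : diffRingType.

Lemma der0 : der (0 : R) = 0.
Proof. by apply: (addrI (der 0)); rewrite -derD !addr0. Qed.
Lemma derN (x : R) : der (- x) = - der x.
Proof. by apply: (addrI (der x)); rewrite -derD !subrr der0. Qed.
Lemma derB (x y : R) : der (x - y) = der x - der y.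
Proof. by rewrite derD derN. Qed.
Lemma der1 : der (1 : R) = 0.
Proof.
by apply: (addrI (der 1)); rewrite addr0 -[RHS](congr1 der (mulr1 1)) derM mulr1 mul1r.
Qed.
End DiffRingTheory.

Section DmorphComp.
Variables (A B C : diffRingType) (u : {dmorphism B -> C}) (v : {dmorphism A -> B}).
Lemma dcomp_der x : (u \o v) (der x) = der ((u \o v) x).
Proof. by rewrite /= !dmorph_der. Qed.
HB.instance Definition _ := isDiffMorphism.Build A C (u \o v) dcomp_der.
End DmorphComp.

Section DmorphId.
Variable A : diffRingType.
HB.instance Definition _ := isDiffMorphism.Build A A idfun (fun _ => erefl).
End DmorphId.

(* The differential ring A all of whose elements are constant. *)
Definition triv (A : Type) : Type := A.
Section Triv.
Variable A : comPzRingType.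
HB.instance Definition _ := GRing.ComPzRing.on (triv A).
Lemma triv_derD : {morph (fun _ : triv A => 0 : triv A) : x y / x + y}.
Proof. by move=> x y; rewrite addr0. Qed.
Lemma triv_derM (x y : triv A) : 0 = 0 * y + x * 0.
Proof. by rewrite mul0r mulr0 addr0. Qed.
HB.instance Definition _ := isDiffRing.Build (triv A) triv_derD triv_derM.
End Triv.

Definition trivm (A B : Type) (f : A -> B) : triv A -> triv B := f.
Section Trivm.
Variables (A B : comPzRingType) (f : {rmorphism A -> B}).
HB.instance Definition _ := GRing.RMorphism.on (trivm f).
HB.instance Definition _ :=
  isDiffMorphism.Build (triv A) (triv B) (trivm f) (fun _ => rmorph0 f).
End Trivm.

Section TensorDer.
Context {L A B : diffRingType}.
Variables (f : {dmorphism L -> A}) (g : {dmorphism L -> B}).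

(* a (x) b |-> da (x) b + a (x) db *)
Definition tder : tensor f g -> tensor f g :=
  tbil (fun a b => tens f g (der a) b + tens f g a (der b)).

Lemma tder_bal :
  balanced f g (fun a b => tens f g (der a) b + tens f g a (der b)).
Proof.
split=> [a a' b|a b b'|a l b].
- by rewrite derD !tensDl addrACA.
- by rewrite derD !tensDr addrACA.
rewrite !derM tensDl tensDr -!dmorph_der !tens_bal -addrA; congr (_ + _).
Qed.

Lemma tderE a b : tder (tens f g a b) = tens f g (der a) b + tens f g a (der b).
Proof. exact: (tbilE tder_bal). Qed.

Lemma tderD : {morph tder : x y / x + y}. Proof. exact: (tbilD tder_bal). Qed.
Lemma tder0 : tder 0 = 0. Proof. exact: (tbil0 tder_bal). Qed.

Lemma tderM x y : tder (x * y) = tder x * y + x * tder y.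
Proof.
elim/(@tens_ind _ _ _ f g): x => [|x x' IH IH'|a b].
- by rewrite !(mul0r, tder0) addr0.
- by rewrite mulrDl !tderD IH IH' !mulrDl addrACA.
elim/(@tens_ind _ _ _ f g): y => [|y y' IH IH'|a' b'].
- by rewrite !(mulr0, tder0) addr0.
- by rewrite mulrDr !tderD IH IH' !mulrDr addrACA.
rewrite tensM !tderE !derM mulrDl mulrDr !tensM tensDl tensDr.
by rewrite addrACA.
Qed.
HB.instance Definition _ := isDiffRing.Build (tensor f g) tderD tderM.

Lemma tinl_der a : tinl f g (der a) = der (tinl f g a).
Proof. by rewrite [RHS]tderE der1 tens0r addr0. Qed.
Lemma tinr_der a : tinr f g (der a) = der (tinr f g a).
Proof. by rewrite [RHS]tderE der1 tens0l add0r. Qed.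
HB.instance Definition _ :=
  isDiffMorphism.Build A (tensor f g) (tinl f g) tinl_der.
HB.instance Definition _ :=
  isDiffMorphism.Build B (tensor f g) (tinr f g) tinr_der.
End TensorDer.

Section LiftDer.
Context {L A B T : diffRingType} {f : {dmorphism L -> A}} {g : {dmorphism L -> B}}.
Variables (u : {dmorphism A -> T}) (v : {dmorphism B -> T}).
Hypothesis uv : forall l, u (f l) = v (g l).

Lemma tlift_der (x : tensor f g) : tlift u v (der x) = der (tlift u v x).
Proof.
have D := tbilD (tlift_bal uv); have Z := tbil0 (tlift_bal uv).
elim/(@tens_ind _ _ _ f g): x => [|x y IH IH'|a b]; first by rewrite der0 /tlift Z der0.
  by rewrite derD /tlift !D derD -IH -IH'.
by rewrite [der (tens _ _ _ _)]tderE /tlift D -!/(tlift u v _) !tliftE //= !dmorph_der derM.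
Qed.

Definition tlift_dmorph : {dmorphism tensor f g -> T} :=
  HB.pack (tlift u v : tensor f g -> T)
    (GRing.isZmodMorphism.Build _ _ _ (tlift_zmod uv))
    (GRing.isMonoidMorphism.Build _ _ _ (tlift_monoid uv))
    (isDiffMorphism.Build _ _ _ tlift_der).
End LiftDer.

Section Constants.
Variable F : diffFieldType.

Definition constant : {pred F} := [pred x | der x == 0].

Lemma constant_closed : divring_closed constant.
Proof.
split=> [|x y|x y]; rewrite !inE ?der1 //.
  by move=> /eqP Hx /eqP Hy; rewrite derB Hx Hy subr0.
move=> /eqP Hx /eqP Hy; rewrite derM Hx mul0r add0r.
have [->|y0] := eqVneq y 0; first by rewrite invr0 der0 mulr0.
have /eqP: der (y * y^-1) = 0 by rewrite divff // der1.
by rewrite derM Hy mul0r add0r mulf_eq0 (negPf y0) /= => /eqP->; rewrite mulr0.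
Qed.
HB.instance Definition _ := GRing.isDivringClosed.Build F constant constant_closed.

Record constants := Constants { constv : F; _ : constv \in constant }.
HB.instance Definition _ := [isSub for constv].
HB.instance Definition _ := [Choice of constants by <:].
HB.instance Definition _ := [SubChoice_isSubIntegralDomain of constants by <:].
HB.instance Definition _ := [SubIntegralDomain_isSubField of constants by <:].

Definition const_incl : triv constants -> F := constv.
Lemma const_incl_zmod : zmod_morphism const_incl.
Proof. exact: (rmorphB (val : {rmorphism constants -> F})). Qed.
Lemma const_incl_monoid : monoid_morphism const_incl.
Proof.
split; first exact: (rmorph1 (val : {rmorphism constants -> F})).
exact: (rmorphM (val : {rmorphism constants -> F})).
Qed.
Lemma const_incl_der x : const_incl (der x) = der (const_incl x).
Proof.
case: x => x Hx; rewrite (eqP (Hx : der x == 0)).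
exact: (rmorph0 (val : {rmorphism constants -> F})).
Qed.
HB.instance Definition _ :=
  GRing.isZmodMorphism.Build (triv constants) F const_incl const_incl_zmod.
HB.instance Definition _ :=
  GRing.isMonoidMorphism.Build (triv constants) F const_incl const_incl_monoid.
HB.instance Definition _ :=
  isDiffMorphism.Build (triv constants) F const_incl const_incl_der.
End Constants.

(* L-algebra homomorphisms from f : L -> A to g : L -> R; for A = L[X] these
   are the elements of X(R). *)
Record alghom (L : Type) (A R : comPzRingType) (f : L -> A) (g : L -> R) :=
  AlgHom {
    alghom_fun :> {rmorphism A -> R};
    alghom_alg : forall l, alghom_fun (f l) = g l
  }.

(* A is generated as an L-algebra by finitely many elements. *)
Definition finite_type (L : Type) (A : comPzRingType) (f : L -> A) : Prop :=
  exists s : seq A, forall P : A -> Prop,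
    (forall l, P (f l)) -> (forall x, x \in s -> P x) ->
    (forall x y, P x -> P y -> P (x + y)) ->
    (forall x y, P x -> P y -> P (x * y)) ->
    forall x, P x.

(* The product of two points x, y : K[G] -> R with respect to the
   comultiplication D. *)
Definition pt_mul (K : Type) (A R : comPzRingType) (f : K -> A)
    (D : A -> tensor f f) (x y : A -> R) : A -> R :=
  tlift x y \o D.

Record linAlgGroup (K : fieldType) := LinAlgGroup {
  grp_ring : comPzRingType;
  grp_alg : {rmorphism K -> grp_ring};
  grp_fin : finite_type grp_alg;
  comul : {rmorphism grp_ring -> tensor grp_alg grp_alg};
  counit : {rmorphism grp_ring -> K};
  antip : {rmorphism grp_ring -> grp_ring};
  comul_alg : forall a, comul (grp_alg a) = tinl _ _ (grp_alg a);
  counit_alg : forall a, counit (grp_alg a) = a;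
  antip_alg : forall a, antip (grp_alg a) = grp_alg a;
  (* G(R) is a group for every K-algebra R. *)
  pt_mulA : forall (R : comPzRingType) (h : {rmorphism K -> R})
    (x y z : alghom grp_alg h),
    pt_mul comul x (pt_mul comul y z) =1 pt_mul comul (pt_mul comul x y) z;
  pt_mul1l : forall (R : comPzRingType) (h : {rmorphism K -> R})
    (x : alghom grp_alg h), pt_mul comul (h \o counit) x =1 x;
  pt_mul1r : forall (R : comPzRingType) (h : {rmorphism K -> R})
    (x : alghom grp_alg h), pt_mul comul x (h \o counit) =1 x;
  pt_mulVl : forall (R : comPzRingType) (h : {rmorphism K -> R})
    (x : alghom grp_alg h), pt_mul comul (x \o antip) x =1 h \o counit;
  pt_mulVr : forall (R : comPzRingType) (h : {rmorphism K -> R})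
    (x : alghom grp_alg h), pt_mul comul x (x \o antip) =1 h \o counit
}.

Section DiffTorsor.
Context {K : fieldType} (G : linAlgGroup K).

(* L[G] = L (x)_K K[G], the elements of K[G] being constant. *)
Definition gcoord (L : diffFieldType) (k : {dmorphism triv K -> L}) :
    diffRingType :=
  tensor k (trivm (grp_alg G)).

Definition galg (L : diffFieldType) (k : {dmorphism triv K -> L}) :
    {dmorphism L -> gcoord k} :=
  tinl k (trivm (grp_alg G)).

Section Space.
Context {L : diffFieldType} (k : {dmorphism triv K -> L}).

(* The point x.g of X(R), for x in X(R) and g in G(R), where R is an L-algebra
   via h. *)
Definition act {S : comPzRingType} {e : L -> S} (rho : S -> tensor e (galg k))
    {R : comPzRingType} (h : L -> R) (x : S -> R) (g : grp_ring G -> R) : S -> R :=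
  tlift x (tlift (f := k) (g := trivm (grp_alg G)) h g) \o rho.

Record is_coaction (S : comPzRingType) (e : L -> S)
    (rho : S -> tensor e (galg k)) : Prop := IsCoaction {
  coact_alg : forall a, rho (e a) = tinl e (galg k) (e a);
  act_one : forall (R : comPzRingType) (h : {rmorphism L -> R})
    (x : alghom e h), act rho h x (h \o k \o counit G) =1 x;
  act_mul : forall (R : comPzRingType) (h : {rmorphism L -> R})
    (x : alghom e h) (g g' : alghom (grp_alg G) (h \o k)),
    act rho h x (pt_mul (comul G) g g') =1 act rho h (act rho h x g) g'
}.

(* The coordinate ring L[X] of an affine scheme X over L with a right
   G_L-action, together with an extension of the derivation of L for which the
   co-action is differential. *)
Record diffGAlg := DiffGAlg {
  dga_ring :> diffRingType;
  dga_alg : {dmorphism L -> dga_ring};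
  coact : {dmorphism dga_ring -> tensor dga_alg (galg k)};
  coactP : is_coaction coact
}.

Definition is_torsor (X : diffGAlg) : Prop :=
  [/\ (1 : X) <> 0, finite_type (dga_alg X) &
      forall (R : comPzRingType) (h : {rmorphism L -> R})
             (x y : alghom (dga_alg X) h),
        exists g : alghom (grp_alg G) (h \o k),
          (forall s, y s = act (coact X) h x g s) /\
          forall g' : alghom (grp_alg G) (h \o k),
            (forall s, y s = act (coact X) h x g' s) -> g' =1 g].

(* An isomorphism of differential G_L-torsors, given by its dual map. *)
Record diffGIso (X Y : diffGAlg) := DiffGIso {
  iso_fun :> {dmorphism X -> Y};
  iso_alg : forall a, iso_fun (dga_alg X a) = dga_alg Y a;
  iso_coact : forall s, coact Y (iso_fun s) = tmap iso_fun idfun (coact X s);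
  iso_bij : bijective iso_fun
}.
End Space.
End DiffTorsor.

Lemma pt_mul_hom (K : Type) (A R : comPzRingType) (f : K -> A) (h : K -> R)
    (D : {rmorphism A -> tensor f f}) (x y : alghom f h) :
  (forall c, D (f c) = tinl f f (f c)) ->
  {z : alghom f h | z =1 pt_mul D x y}.
Proof.
move=> Df; have xy c : x (f c) = y (f c) by rewrite !alghom_alg.
have [w wE] := tlift_rmorph xy.
have wD c : (w \o D) (f c) = h c.
  by rewrite /= wE Df (tlift_inl xy) alghom_alg.
by exists (AlgHom wD) => a; rewrite /= wE.
Qed.

Section ActHom.
Context {K : fieldType} (G : linAlgGroup K).
Context {L : diffFieldType} (k : {dmorphism triv K -> L}).
Context {R : comPzRingType} (h : {rmorphism L -> R}).
Variable g : alghom (grp_alg G) (h \o k).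

Lemma gpt_compat c : h (k c) = g (trivm (grp_alg G) c).
Proof. by rewrite /trivm alghom_alg. Qed.

Lemma gpt_hom : {w : {rmorphism gcoord G k -> R} |
  [/\ w =1 tlift (f := k) (g := trivm (grp_alg G)) h g, forall a, w (galg G k a) = h a &
      forall c, w (tinr k (trivm (grp_alg G)) c) = g c]}.
Proof.
have [w wE] := tlift_rmorph (v := (g : {rmorphism triv (grp_ring G) -> R})) gpt_compat.
exists w; split=> // [a|c]; rewrite wE.
  exact: (tlift_inl (v := (g : {rmorphism triv (grp_ring G) -> R})) gpt_compat).
exact: (tlift_inr (v := (g : {rmorphism triv (grp_ring G) -> R})) gpt_compat).
Qed.

Context {S : comPzRingType} {e : L -> S}.
Variable x : alghom e h.

Lemma act_hom0 : {w : {rmorphism tensor e (galg G k) -> R} |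
  [/\ w =1 tlift x (tlift (f := k) (g := trivm (grp_alg G)) h g),
      forall s, w (tinl e (galg G k) s) = x s &
      forall c, w (tinr e (galg G k) c) =
                tlift (f := k) (g := trivm (grp_alg G)) h g c]}.
Proof.
have [w [wE wl wr]] := gpt_hom.
have xw a : x (e a) = w (galg G k a) by rewrite wl alghom_alg.
have -> : tlift (f := k) (g := trivm (grp_alg G)) h g = w by apply/funext => z; rewrite wE.
have [v vE] := tlift_rmorph xw.
by exists v; split=> // z; rewrite vE ?(tlift_inl xw) ?(tlift_inr xw).
Qed.

Lemma act_hom (rho : {rmorphism S -> tensor e (galg G k)}) :
  (forall a, rho (e a) = tinl e (galg G k) (e a)) ->
  {z : alghom e h | z =1 act rho h x g}.
Proof.
move=> rhoe; have [w [wE wl _]] := act_hom0.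
have P a : (w \o rho) (e a) = h a by rewrite /= rhoe wl alghom_alg.
by exists (AlgHom P) => s; rewrite /= wE.
Qed.
End ActHom.

Section BaseChange.
Context {K : fieldType} (G : linAlgGroup K) {L L' : diffFieldType}
  {k : {dmorphism triv K -> L}} {k' : {dmorphism triv K -> L'}}
  (l : {dmorphism L -> L'}).

(* L[G] -> L'[G] *)
Definition gmap : gcoord G k -> gcoord G k' := tmap l idfun.

Hypothesis lk : forall c, l (k c) = k' c.
Variable X : diffGAlg G k.
Local Notation e := (dga_alg X).
Local Notation LS := (tensor l e).
Local Notation eLS := (tinl l e : {dmorphism L' -> LS}).
Local Notation T := (tensor eLS (galg G k')).

Lemma gmap_compat c :
  (tinl k' (trivm (grp_alg G)) \o l) (k c) =
  tinr k' (trivm (grp_alg G)) (trivm (grp_alg G) c).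
Proof. by rewrite /= lk tinlr. Qed.

Definition gmap_dmorph : {dmorphism gcoord G k -> gcoord G k'} :=
  tlift_dmorph gmap_compat.

Lemma bc_compat1 a : (tinl eLS (galg G k') \o tinr l e) (e a) =
  (tinr eLS (galg G k') \o gmap_dmorph) (galg G k a).
Proof. by rewrite /= (tlift_inl gmap_compat) /= -tinlr -[RHS]tinlr. Qed.

(* S -> S (x)_L L[G] -> (L' (x)_L S) (x)_L' L'[G] *)
Definition bc_coact1 : {dmorphism X -> T} :=
  tlift_dmorph bc_compat1 \o coact X.

Lemma bc_compat2 a : (tinl eLS (galg G k') \o eLS) (l a) = bc_coact1 (e a).
Proof.
by rewrite /= (coact_alg (coactP X)) (tlift_inl bc_compat1) /= -tinlr.
Qed.

Definition bc_coact : {dmorphism LS -> T} := tlift_dmorph bc_compat2.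


Lemma bc_coact_alg a : bc_coact (eLS a) = tinl eLS (galg G k') (eLS a).
Proof. exact: (tlift_inl bc_compat2). Qed.

Section Act.
Variables (R : comPzRingType) (h : {rmorphism L' -> R}).

Lemma bc_pt_alg (x : alghom eLS h) a :
  ((x : {rmorphism LS -> R}) \o tinr l e) (e a) = (h \o l) a.
Proof. by rewrite /= -tinlr alghom_alg. Qed.
Definition bc_pt (x : alghom eLS h) : alghom e (h \o l) := AlgHom (bc_pt_alg x).

Lemma bc_gpt_alg (g : alghom (grp_alg G) (h \o k')) c :
  (g : {rmorphism grp_ring G -> R}) (grp_alg G c) = ((h \o l) \o k) c.
Proof. by rewrite alghom_alg /= lk. Qed.
Definition bc_gpt (g : alghom (grp_alg G) (h \o k')) :
  alghom (grp_alg G) ((h \o l) \o k) := AlgHom (bc_gpt_alg g).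

Lemma bc_act_inr (x : alghom eLS h) (g : alghom (grp_alg G) (h \o k')) s :
  act bc_coact h x g (tinr l e s) = act (coact X) (h \o l) (bc_pt x) (bc_gpt g) s.
Proof.
have [W [WE Wl Wr]] := act_hom0 g x.
have [w [wE wl wr]] := gpt_hom g.
have [V [VE Vl Vr]] := act_hom0 (bc_gpt g) (bc_pt x).
have [v [vE vl vr]] := gpt_hom (bc_gpt g).
have E : bc_coact (tinr l e s) = bc_coact1 s := tlift_inr bc_compat2 s.
rewrite /act -[LHS]WE -[RHS]VE; change (W (bc_coact (tinr l e s)) = V (coact X s)); rewrite E.
have gm c : w (gmap_dmorph c) = v c.
  have H : w \o gmap_dmorph =1 v.
    apply: tens_eq_hom => [a|b].
      apply: etrans (congr1 w (tlift_inl gmap_compat a)) _.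
      by rewrite [LHS]wl [RHS]vl.
    apply: etrans (congr1 w (tlift_inr gmap_compat b)) _.
    by rewrite [LHS]wr [RHS]vr.
  exact: H.
have H : W \o tlift_dmorph bc_compat1 =1 V.
  apply: tens_eq_hom => [a|b].
    apply: etrans (congr1 W (tlift_inl bc_compat1 a)) _.
    by rewrite [LHS]Wl [RHS]Vl.
  apply: etrans (congr1 W (tlift_inr bc_compat1 b)) _.
  by rewrite [LHS]Wr [RHS]Vr -[LHS]wE -[RHS]vE gm.
exact: H.
Qed.
End Act.

Lemma bc_coactP : is_coaction bc_coact.
Proof.
split=> [|R h x z|R h x g g' z]; first exact: bc_coact_alg.
- have c1_alg c : (h \o k' \o counit G) (grp_alg G c) = (h \o k') c.
    by rewrite /= counit_alg.
  pose c1 : alghom (grp_alg G) (h \o k') :=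
    AlgHom (alghom_fun := h \o k' \o counit G) c1_alg.
  have [w wE] := act_hom c1 x bc_coact_alg.
  rewrite -[LHS](wE z); move: z; apply: tens_eq_hom => [a|s].
    by rewrite !alghom_alg.
  rewrite [LHS]wE bc_act_inr.
  have -> : (bc_gpt c1 : _ -> _) = (h \o l) \o k \o counit G.
    by apply/funext => c; rewrite /= lk.
  exact: (act_one (coactP X) (bc_pt x)).
have [gg ggE] := pt_mul_hom g g' (comul_alg G).
have [w wE] := act_hom gg x bc_coact_alg.
have [w1 w1E] := act_hom g x bc_coact_alg.
have [w2 w2E] := act_hom g' w1 bc_coact_alg.
have -> : pt_mul (comul G) g g' = gg by apply/funext => c; rewrite ggE.
have -> : act bc_coact h x g = w1 by apply/funext => c; rewrite w1E.
rewrite -[LHS](wE z) -[RHS](w2E z); move: z; apply: tens_eq_hom => [a|s].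
  by rewrite !alghom_alg.
rewrite [LHS]wE [RHS]w2E !bc_act_inr.
have -> : (bc_gpt gg : _ -> _) = pt_mul (comul G) (bc_gpt g) (bc_gpt g').
  by apply/funext => c; rewrite [LHS]ggE.
have -> : (bc_pt w1 : _ -> _) = act (coact X) (h \o l) (bc_pt x) (bc_gpt g).
  by apply/funext => c; rewrite -bc_act_inr -w1E.
exact: (act_mul (coactP X) (bc_pt x)).
Qed.

Definition base_change : diffGAlg G k' := DiffGAlg bc_coactP.
End BaseChange.

(* The limit of rings R i, i in V + E, along maps R (lE k), R (rE k) -> R k for
   k in E, as the ring of compatible families. *)
Section InvLim.
Context {V E : Type} {lE rE : E -> V} {R : V + E -> diffRingType}.
Variables (pl : forall k, {dmorphism R (inl (lE k)) -> R (inr k)})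
          (pr : forall k, {dmorphism R (inl (rE k)) -> R (inr k)}).

Record invlim := InvLim {
  lproj : forall i, R i;
  lproj_l : forall k, pl k (lproj (inl (lE k))) = lproj (inr k);
  lproj_r : forall k, pr k (lproj (inl (rE k))) = lproj (inr k)
}.

HB.instance Definition _ := gen_eqMixin invlim.
HB.instance Definition _ := gen_choiceMixin invlim.

Lemma invlim_eq (s t : invlim) : (forall i, lproj s i = lproj t i) -> s = t.
Proof.
case: s t => [s sl sr] [t tl tr] /= st.
have E0 : s = t by apply: functional_extensionality_dep.
by move: sl sr; rewrite {}E0 => sl sr; congr InvLim; apply: Prop_irrelevance.
Qed.

Definition lim_zero : invlim :=
  @InvLim (fun=> 0) (fun k => rmorph0 (pl k)) (fun k => rmorph0 (pr k)).
Definition lim_one : invlim :=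
  @InvLim (fun=> 1) (fun k => rmorph1 (pl k)) (fun k => rmorph1 (pr k)).

Program Definition lim_opp (s : invlim) : invlim :=
  @InvLim (fun i => - lproj s i) _ _.
Next Obligation. by rewrite rmorphN /= lproj_l. Qed.
Next Obligation. by rewrite rmorphN /= lproj_r. Qed.

Program Definition lim_add (s t : invlim) : invlim :=
  @InvLim (fun i => lproj s i + lproj t i) _ _.
Next Obligation. by rewrite rmorphD /= !lproj_l. Qed.
Next Obligation. by rewrite rmorphD /= !lproj_r. Qed.

Program Definition lim_mul (s t : invlim) : invlim :=
  @InvLim (fun i => lproj s i * lproj t i) _ _.
Next Obligation. by rewrite rmorphM /= !lproj_l. Qed.
Next Obligation. by rewrite rmorphM /= !lproj_r. Qed.

Program Definition lim_der (s : invlim) : invlim :=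
  @InvLim (fun i => der (lproj s i)) _ _.
Next Obligation. by rewrite dmorph_der lproj_l. Qed.
Next Obligation. by rewrite dmorph_der lproj_r. Qed.

Lemma lim_addA : associative lim_add.
Proof. by move=> s t u; apply: invlim_eq => i /=; rewrite addrA. Qed.
Lemma lim_addC : commutative lim_add.
Proof. by move=> s t; apply: invlim_eq => i /=; rewrite addrC. Qed.
Lemma lim_add0 : left_id lim_zero lim_add.
Proof. by move=> s; apply: invlim_eq => i /=; rewrite add0r. Qed.
Lemma lim_addN : left_inverse lim_zero lim_opp lim_add.
Proof. by move=> s; apply: invlim_eq => i /=; rewrite addNr. Qed.
HB.instance Definition _ :=
  GRing.isZmodule.Build invlim lim_addA lim_addC lim_add0 lim_addN.

Lemma lim_mulA : associative lim_mul.
Proof. by move=> s t u; apply: invlim_eq => i /=; rewrite mulrA. Qed.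
Lemma lim_mulC : commutative lim_mul.
Proof. by move=> s t; apply: invlim_eq => i /=; rewrite mulrC. Qed.
Lemma lim_mul1 : left_id lim_one lim_mul.
Proof. by move=> s; apply: invlim_eq => i /=; rewrite mul1r. Qed.
Lemma lim_mulDl : left_distributive lim_mul +%R.
Proof. by move=> s t u; apply: invlim_eq => i /=; rewrite mulrDl. Qed.
HB.instance Definition _ :=
  GRing.Zmodule_isComPzRing.Build invlim lim_mulA lim_mulC lim_mul1 lim_mulDl.

Lemma lim_derD : {morph lim_der : s t / s + t}.
Proof. by move=> s t; apply: invlim_eq => i /=; rewrite derD. Qed.
Lemma lim_derM (s t : invlim) : lim_der (s * t) = lim_der s * t + s * lim_der t.
Proof. by apply: invlim_eq => i /=; rewrite derM. Qed.
HB.instance Definition _ := isDiffRing.Build invlim lim_derD lim_derM.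

Section Cone.
Context {S : diffRingType}.
Variable u : forall i, {dmorphism S -> R i}.
Hypothesis ul : forall k s, pl k (u (inl (lE k)) s) = u (inr k) s.
Hypothesis ur : forall k s, pr k (u (inl (rE k)) s) = u (inr k) s.

Definition lim_map (s : S) : invlim :=
  @InvLim (fun i => u i s) (fun k => ul k s) (fun k => ur k s).

Lemma lim_map_zmod : zmod_morphism lim_map.
Proof. by move=> s t; apply: invlim_eq => i /=; rewrite rmorphB. Qed.
Lemma lim_map_monoid : monoid_morphism lim_map.
Proof.
by split=> [|s t]; apply: invlim_eq => i /=; rewrite ?rmorph1 ?rmorphM.
Qed.
Lemma lim_map_der s : lim_map (der s) = der (lim_map s).
Proof. by apply: invlim_eq => i /=; rewrite dmorph_der. Qed.
HB.instance Definition _ :=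
  GRing.isZmodMorphism.Build S invlim lim_map lim_map_zmod.
HB.instance Definition _ :=
  GRing.isMonoidMorphism.Build S invlim lim_map lim_map_monoid.
HB.instance Definition _ :=
  isDiffMorphism.Build S invlim lim_map lim_map_der.
End Cone.
End InvLim.

(* The index set is fsV + fsE, with fsV for I_v and fsE for I_e; the two
   indices l_k, r_k above k in I_e are fs_l k and fs_r k.  The last three fields
   say that the cone fs_in exhibits F as the limit. *)
Record diffFactSystem (F : diffFieldType) := DiffFactSystem {
  fsV : finType;
  fsE : finType;
  fs_l : fsE -> fsV;
  fs_r : fsE -> fsV;
  fs_lr : forall k, fs_l k <> fs_r k;
  fs_fld : fsV + fsE -> diffFieldType;
  fs_char0 : forall i, [pchar (fs_fld i)] =i pred0;
  fs_pl : forall k, {dmorphism fs_fld (inl (fs_l k)) -> fs_fld (inr k)};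
  fs_pr : forall k, {dmorphism fs_fld (inl (fs_r k)) -> fs_fld (inr k)};
  fs_in : forall i, {dmorphism F -> fs_fld i};
  fs_inl : forall k a, fs_pl k (fs_in (inl (fs_l k)) a) = fs_in (inr k) a;
  fs_inr : forall k a, fs_pr k (fs_in (inl (fs_r k)) a) = fs_in (inr k) a;
  fs_lim : bijective (lim_map (R := fun i => fs_fld i : diffRingType)
                              (u := fs_in) fs_inl fs_inr)
}.

Arguments fs_l {F} d k.
Arguments fs_r {F} d k.
Arguments fs_fld {F} d i.
Arguments fs_pl {F} d k.
Arguments fs_pr {F} d k.
Arguments fs_in {F} d i.

Definition simult_fact (F : diffFieldType) (Y : diffFactSystem F) : Prop :=
  forall (n : nat) (A : forall k : fsE Y, 'M[fs_fld Y (inr k)]_n), (0 < n)%N ->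
    (forall k, A k \in unitmx) ->
    exists B : forall i : fsV Y, 'M[fs_fld Y (inl i)]_n,
      (forall i, B i \in unitmx) /\
      forall k, A k = invmx (map_mx (fs_pr Y k) (B (fs_r Y k)))
                      *m map_mx (fs_pl Y k) (B (fs_l Y k)).

Section Patching.
Context {F : diffFieldType} (Y : diffFactSystem F) (G : linAlgGroup (constants F)).

Definition fs_const i : {dmorphism triv (constants F) -> fs_fld Y i} :=
  fs_in Y i \o @const_incl F.

Lemma fs_const_in i c : fs_in Y i (const_incl c) = fs_const i c.
Proof. by []. Qed.
Lemma fs_const_l k c : fs_pl Y k (fs_const (inl (fs_l Y k)) c) = fs_const (inr k) c.
Proof. exact: fs_inl. Qed.
Lemma fs_const_r k c : fs_pr Y k (fs_const (inl (fs_r Y k)) c) = fs_const (inr k) c.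
Proof. exact: fs_inr. Qed.

Record patching := Patching {
  pp_obj : forall i, diffGAlg G (fs_const i);
  pp_torsor : forall i, is_torsor (pp_obj i);
  pp_thl : forall k, diffGIso
    (base_change (@fs_const_l k) (pp_obj (inl (fs_l Y k)))) (pp_obj (inr k));
  pp_thr : forall k, diffGIso
    (base_change (@fs_const_r k) (pp_obj (inl (fs_r Y k)))) (pp_obj (inr k))
}.
Variable P : patching.

Definition extend i (X : diffGAlg G (@const_incl F)) : diffGAlg G (fs_const i) :=
  base_change (@fs_const_in i) X.

Section Solution.
Variables (X : diffGAlg G (@const_incl F))
  (Phi : forall i : fsV Y, diffGIso (extend (inl i) X) (pp_obj P (inl i))).

(* id (x) Phi_(l_k) : F_k (x)_F S -> F_k (x)_(F_(l_k)) S_(l_k), where the source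
   is identified with F_k (x)_(F_(l_k)) (F_(l_k) (x)_F S). *)
Definition phi_l k (x : tensor (fs_in Y (inr k)) (dga_alg X)) :
    tensor (fs_pl Y k) (dga_alg (pp_obj P (inl (fs_l Y k)))) :=
  tmap idfun (Phi (fs_l Y k) \o tinr _ _) x.

Definition phi_r k (x : tensor (fs_in Y (inr k)) (dga_alg X)) :
    tensor (fs_pr Y k) (dga_alg (pp_obj P (inl (fs_r Y k)))) :=
  tmap idfun (Phi (fs_r Y k) \o tinr _ _) x.

Definition is_solution : Prop :=
  is_torsor X /\ forall k, pp_thl P k \o @phi_l k =1 pp_thr P k \o @phi_r k.
End Solution.

(* S_i -> F_k (x)_(F_i) S_i -> S_k *)
Definition pp_ml k :
    {dmorphism pp_obj P (inl (fs_l Y k)) -> pp_obj P (inr k)} :=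
  pp_thl P k \o tinr _ _.
Definition pp_mr k :
    {dmorphism pp_obj P (inl (fs_r Y k)) -> pp_obj P (inr k)} :=
  pp_thr P k \o tinr _ _.

Definition pp_lim : diffRingType :=
  invlim (lE := fs_l Y) (rE := fs_r Y) (R := fun i => pp_obj P i) pp_ml pp_mr.

Definition pp_proj i (s : pp_lim) : pp_obj P i := lproj s i.

(* F[G] -> F_i[G] *)
Definition pp_gmap i : gcoord G (@const_incl F) -> gcoord G (fs_const i) :=
  gmap (fs_in Y i).

Definition pp_alg i : {dmorphism F -> pp_obj P i} :=
  dga_alg (pp_obj P i) \o fs_in Y i.

Lemma pp_alg_l k a : pp_ml k (pp_alg (inl (fs_l Y k)) a) = pp_alg (inr k) a.
Proof.
rewrite /= -fs_inl -[RHS](iso_alg (pp_thl P k)); congr (pp_thl P k _).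
exact/esym/tinlr.
Qed.
Lemma pp_alg_r k a : pp_mr k (pp_alg (inl (fs_r Y k)) a) = pp_alg (inr k) a.
Proof.
rewrite /= -fs_inr -[RHS](iso_alg (pp_thr P k)); congr (pp_thr P k _).
exact/esym/tinlr.
Qed.

Definition pp_lim_alg : {dmorphism F -> pp_lim} :=
  lim_map (R := fun i => pp_obj P i) (u := pp_alg) pp_alg_l pp_alg_r.
End Patching.

(* Main.v *)
(* G-equivariance reduces the patching of the infinite-dimensional rings S_i to
   that of finite-dimensional spaces.  For a finite-dimensional W in K[G], put
   S_i(W) = {s | rho(s) in S_i (x)_K W}.  It is finite-dimensional because S_i is a
   torsor, its formation commutes with base change, and S_i is the union of the
   S_i(W).  The simultaneous factorization property gives bases of the S_i(W)
   which agree in all S_k(W), i.e. a basis lying in S = lim S_i, whence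
   F_i (x)_F S = S_i.  The co-action on S is glued coefficientwise, and the torsor
   axioms descend along F -> F_i by means of an F-linear retraction F_i -> F. *)

Require Import Defs.
From HB Require Import structures.
From mathcomp Require Import all_boot all_algebra.
From mathcomp Require Import boolp classical_sets.

Set Implicit Arguments.
Unset Strict Implicit.
Unset Printing Implicit Defensive.

Import GRing.Theory.
Local Open Scope ring_scope.

(** * Linear algebra over a structure map *)

(* A is viewed as an L-module through f : L -> A. *)
Section LinearAlgebra.
Context {L : fieldType} {A : comPzRingType} (f : {rmorphism L -> A}).

(** The factorization hypothesis concerns matrices of one finite size over all F_k, whereas the S_i
    may be infinite-dimensional. The spaces W are taken over K because K maps to every F_i: a single
    W then serves all indices, and coefficients with respect to it are respected by all transition
    maps. The S_i(W) must have the same dimension at all vertices. Along one k in I_e this is base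
    change; globally it holds because F is a field, which forces the system to be connected.
    Independence over a field and functionals from Zorn's lemma take the role of faithful flatness.
    An L-linear psi : L' -> L with psi 1 = 1 makes R -> L' (x)_L R injective, and contraction with
    psi recovers elements of R. Elements of S (x)_K K[G] are determined by their images under id (x)
    phi, for phi a K-linear functional on K[G], so identities between co-actions reduce to
    identities in S. *)

Definition subspace (U : A -> Prop) : Prop :=
  [/\ U 0, forall a b, U a -> U b -> U (a + b) & forall l a, U a -> U (f l * a)].

Definition lin_indep n (b : 'I_n -> A) : Prop :=
  forall x : 'I_n -> L, \sum_j f (x j) * b j = 0 -> forall j, x j = 0.

Definition inspan n (b : 'I_n -> A) (a : A) : Prop :=
  exists x : 'I_n -> L, a = \sum_j f (x j) * b j.

Definition is_basis n (U : A -> Prop) (b : 'I_n -> A) : Prop :=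
  [/\ forall j, U (b j), lin_indep b & forall a, U a -> inspan b a].

Lemma subspace_sum (U : A -> Prop) (I : finType) (x : I -> L) (b : I -> A) :
  subspace U -> (forall j, U (b j)) -> U (\sum_j f (x j) * b j).
Proof. by move=> [U0 UD UZ] Ub; elim/big_ind: _ => // i _; apply: UZ. Qed.

Lemma subspace_sub (U : A -> Prop) a b :
  subspace U -> U a -> U b -> U (a - b).
Proof.
move=> [_ UD UZ] Ua Ub; apply: UD => //; rewrite -mulN1r -(rmorph1 f) -rmorphN.
exact: UZ.
Qed.

Lemma inspan_subspace n (b : 'I_n -> A) : subspace (inspan b).
Proof.
split=> [|a c [x ->] [y ->]|l a [x ->]].
- by exists (fun=> 0); rewrite big1 // => j _; rewrite rmorph0 mul0r.
- exists (fun j => x j + y j); rewrite -big_split; apply: eq_bigr => j _ /=.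
  by rewrite rmorphD mulrDl.
- exists (fun j => l * x j); rewrite mulr_sumr; apply: eq_bigr => j _.
  by rewrite rmorphM mulrA.
Qed.

Lemma inspan_mem n (b : 'I_n -> A) j : inspan b (b j).
Proof.
exists (fun i => (i == j)%:R); rewrite (bigD1 j) //= eqxx rmorph1 mul1r.
by rewrite big1 ?addr0 // => i /negPf->; rewrite rmorph0 mul0r.
Qed.

Lemma inspan_trans n (b : 'I_n -> A) m (c : 'I_m -> A) a :
  (forall j, inspan c (b j)) -> inspan b a -> inspan c a.
Proof.
by move=> bc [x ->]; apply: subspace_sum bc; apply: inspan_subspace.
Qed.

Lemma free_coef n (b : 'I_n -> A) (x y : 'I_n -> L) : lin_indep b ->
  \sum_j f (x j) * b j = \sum_j f (y j) * b j -> x =1 y.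
Proof.
move=> fb E j; apply/eqP; rewrite -subr_eq0; apply/eqP.
apply: (fb (fun j => x j - y j)); rewrite (eq_bigr _ (fun i _ => congr1 (fun z => z * b i) (rmorphB f _ _))).
by rewrite (eq_bigr _ (fun i _ => mulrBl _ _ _)) sumrB E subrr.
Qed.

Lemma inspan_matrix n (b : 'I_n -> A) m (c : 'I_m -> A) :
  (forall i, inspan b (c i)) ->
  exists M : 'M[L]_(m, n), forall i, c i = \sum_j f (M i j) * b j.
Proof.
move=> /choice[x xE]; exists (\matrix_(i, j) x i j) => i; rewrite [LHS]xE.
by apply: eq_bigr => j _; rewrite mxE.
Qed.

Lemma sum_mulmx m n p (M : 'M[L]_(m, n)) (N : 'M[L]_(n, p)) (b : 'I_p -> A) i :
  \sum_j f (M i j) * (\sum_q f (N j q) * b q) = \sum_q f ((M *m N) i q) * b q.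
Proof.
under eq_bigr => j _ do rewrite mulr_sumr.
rewrite exchange_big; apply: eq_bigr => q _ /=.
rewrite !mxE rmorph_sum mulr_suml; apply: eq_bigr => j _.
by rewrite mulrA -rmorphM.
Qed.

Lemma sum_scalar1 n (b : 'I_n -> A) i :
  \sum_q f ((1%:M : 'M[L]_n) i q) * b q = b i.
Proof.
rewrite (bigD1 i) //= mxE eqxx rmorph1 mul1r big1 ?addr0 // => j.
by rewrite eq_sym mxE => /negPf->; rewrite rmorph0 mul0r.
Qed.

Lemma free_mulmx_inv m n (b : 'I_n -> A) (c : 'I_m -> A)
    (M : 'M[L]_(m, n)) (N : 'M[L]_(n, m)) :
  (forall i, c i = \sum_j f (M i j) * b j) ->
  (forall j, b j = \sum_i f (N j i) * c i) -> lin_indep b -> N *m M = 1%:M.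
Proof.
move=> cE bE fb; apply/matrixP => i j; apply: (free_coef fb (x := (N *m M) i)).
rewrite -sum_mulmx sum_scalar1 [RHS]bE; apply: eq_bigr => q _.
by rewrite -cE.
Qed.

(** A row of the kernel of the coefficient matrix is a linear relation among the [b i]. Independence
    makes this kernel zero, so the m by n matrix has rank m. *)
Lemma free_le_span m n (b : 'I_m -> A) (c : 'I_n -> A) :
  lin_indep b -> (forall i, inspan c (b i)) -> (m <= n)%N.
Proof.
move=> fb /inspan_matrix[M bE].
suff kM0 : kermx M = 0.
  have := mxrank_ker M; rewrite kM0 mxrank0 => /esym/eqP; rewrite subn_eq0.
  by move=> /leq_trans; apply; apply: rank_leq_col.
apply/matrixP => i j; rewrite [RHS]mxE; apply: (fb (fun j => kermx M i j)).
have kM : kermx M *m M = 0 by apply/sub_kermxP.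
under eq_bigr => q _ do rewrite bE.
rewrite sum_mulmx kM big1 // => q _; by rewrite mxE rmorph0 mul0r.
Qed.

Lemma basis_size (U : A -> Prop) m n (b : 'I_m -> A) (c : 'I_n -> A) :
  is_basis U b -> is_basis U c -> m = n.
Proof.
move=> [Ub fb sb] [Uc fc sc]; apply/eqP; rewrite eqn_leq.
by rewrite (free_le_span fb (fun i => sc _ (Ub i)))
           (free_le_span fc (fun i => sb _ (Uc i))).
Qed.

Lemma basis_change (U : A -> Prop) n (b c : 'I_n -> A) :
  is_basis U b -> is_basis U c ->
  exists2 M : 'M[L]_n, M \in unitmx & forall i, c i = \sum_j f (M i j) * b j.
Proof.
move=> [Ub fb sb] [Uc fc sc].
have [M cE] := inspan_matrix (fun i => sb _ (Uc i)).
have [N bE] := inspan_matrix (fun i => sc _ (Ub i)).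
by exists M => //; have /mulmx1_unit[] := free_mulmx_inv cE bE fb.
Qed.

Lemma basis_mulmx (U : A -> Prop) n (b : 'I_n -> A) (M : 'M[L]_n) :
  subspace U -> M \in unitmx -> is_basis U b ->
  is_basis U (fun i => \sum_j f (M i j) * b j).
Proof.
move=> sU uM [Ub fb sb].
have bE i : b i = \sum_p f (invmx M i p) * (\sum_j f (M p j) * b j).
  by rewrite sum_mulmx mulVmx // sum_scalar1.
split=> [j|x xE j|a Ua]; first exact: subspace_sum.
  pose r := \row_j x j; have rM : r *m M = 0.
    apply/matrixP => i q; rewrite [RHS]mxE; apply: (fb (fun q => (r *m M) i q)).
    rewrite -sum_mulmx -[RHS]xE; apply: eq_bigr => p _; by rewrite mxE.
  have /matrixP/(_ ord0 j) : r = 0 by rewrite -(mulmxK uM r) rM mul0mx.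
  by rewrite !mxE.
apply: inspan_trans (sb _ Ua) => i; exists (invmx M i); exact: bE.
Qed.

(** Independent families in [U] have length at most n, so a longest one exists; an element outside
    its span could be prepended to it. *)
Lemma subspace_basis (U : A -> Prop) n (c : 'I_n -> A) :
  subspace U -> (forall a, U a -> inspan c a) ->
  exists m (b : 'I_m -> A), is_basis U b.
Proof.
move=> sU Uc; pose P m := `[< exists b : 'I_m -> A, (forall j, U (b j)) /\ lin_indep b >].
have P0 : exists m, P m.
  by exists 0%N; apply/asboolP; exists (fun=> 0); split=> [[]|x _ []].
have Pn m : P m -> (m <= n)%N.
  by move=> /asboolP[b [Ub fb]]; apply: free_le_span fb (fun i => Uc _ (Ub i)).
case: (ex_maxnP P0 Pn) => m /asboolP[b [Ub fb]] mmax; exists m, b; split=> // a Ua.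
apply: contrapT => ab; suff /mmax : P m.+1 by rewrite ltnn.
apply/asboolP; exists (fun i => oapp b a (unlift ord0 i)); split=> [j|x].
  by case: (unliftP ord0 j) => [i _|_] /=.
rewrite big_ord_recl unlift_none /=.
under eq_bigr => i _ do rewrite liftK /=.
move=> xE; have x0 : x ord0 = 0.
  apply: contrapT => /eqP x0; apply: ab.
  exists (fun j => - (x ord0)^-1 * x (lift ord0 j)).
  have -> : a = f (x ord0)^-1 * (f (x ord0) * a).
    by rewrite mulrA -rmorphM mulVf // rmorph1 mul1r.
  rewrite (eqP (_ : f (x ord0) * a == - \sum_i f (x (lift ord0 i)) * b i)); last first.
    by rewrite -addr_eq0 xE.
  rewrite mulrN mulr_sumr -sumrN; apply: eq_bigr => j _.
  by rewrite rmorphM rmorphN !mulNr mulrA.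
move=> j; case: (unliftP ord0 j) => [i ->|-> //].
move: xE; rewrite x0 rmorph0 mul0r add0r => /fb; exact.
Qed.

Lemma seq_basis (s : seq A) :
  exists n (b : 'I_n -> A), lin_indep b /\ forall a, a \in s -> inspan b a.
Proof.
pose c (i : 'I_(size s)) := nth 0 s i.
have [n [b [_ fb bc]]] := subspace_basis (inspan_subspace c) (fun a ca => ca).
exists n, b; split=> // a /(nthP 0)[i ilt <-]; apply: bc.
exact: (inspan_mem c (Ordinal ilt)).
Qed.

Lemma seq_span (s : seq A) :
  exists n (b : 'I_n -> A), forall a, a \in s -> inspan b a.
Proof. by have [n [b [_ ?]]] := seq_basis s; exists n, b. Qed.

End LinearAlgebra.

(** * Linear functionals and separation *)

Definition linfunc {L A : comPzRingType} (f : L -> A) (phi : A -> L) : Prop :=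
  (forall a b, phi (a + b) = phi a + phi b) /\
  (forall l a, phi (f l * a) = l * phi a).

Section Linfunc.
Context {L A : comPzRingType} {f : L -> A} {phi : A -> L}.
Hypothesis phiP : linfunc f phi.

Lemma linfunc0 : phi 0 = 0.
Proof. by apply: (addrI (phi 0)); rewrite -phiP.1 !addr0. Qed.

Lemma linfunc_sum (I : Type) (r : seq I) (F : I -> A) :
  phi (\sum_(i <- r) F i) = \sum_(i <- r) phi (F i).
Proof. exact: (big_morph phi phiP.1 linfunc0). Qed.

Lemma linfunc_comb n (x : 'I_n -> L) (b : 'I_n -> A) :
  phi (\sum_j f (x j) * b j) = \sum_j x j * phi (b j).
Proof. by rewrite linfunc_sum; apply: eq_bigr => j _; rewrite phiP.2. Qed.
End Linfunc.

Section Separation.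
Context {L : fieldType} {A : comPzRingType} (f : {rmorphism L -> A}).

(** A subspace M maximal among those containing [U] and avoiding [r] is a complement of the line
    through [r]; phi a is the coordinate of a along [r]. *)
Lemma linfunc_sep (U : A -> Prop) (r : A) : subspace f U -> ~ U r ->
  exists phi, [/\ linfunc f phi, forall a, U a -> phi a = 0 & phi r = 1].
Proof.
move=> sU Ur.
pose P (M : set A) := M = set0 \/
  [/\ subspace f M, forall a, U a -> M a & ~ M r].
have [|M [MP Mmax]] := @Zorn_bigcup _ P.
  move=> C CP Ctot; have [[M [CM /set0P/eqP M0]]|C0] := pselect (exists M, C M /\ (M !=set0)%classic); last first.
    left; apply/seteqP; split=> // a [M CM Ma].
    by case: C0; exists M; split=> //; exists a.
  have CP' N a : C N -> N a -> [/\ subspace f N, forall a, U a -> N a & ~ N r].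
    by move=> /CP[->|].
  case: (CP M CM) => // [[[_ _ _] UM Mr]]; right; split.
  - split=> [|a b [N1 C1 a1] [N2 C2 b2]|l a [N CN Na]].
    + by exists M => //; apply: UM; case: sU.
    + have [|N12] := Ctot _ _ C1 C2.
        move=> N12; have [[_ ND _] _ _] := CP' _ _ C2 b2.
        by exists N2 => //; apply: ND => //; apply: N12.
      have [[_ ND _] _ _] := CP' _ _ C1 a1.
      by exists N1 => //; apply: ND => //; apply: N12.
    + by have [[_ _ NZ] _ _] := CP' _ _ CN Na; exists N => //; apply: NZ.
  - by move=> a Ua; exists M => //; apply: UM.
  - by move=> [N CN Nr]; have [_ _] := CP' _ _ CN Nr.
have [M0|[sM UM Mr]] := MP.
  case: (Mmax U); last by right.
  by rewrite M0; split=> // /(_ 0); apply; case: sU.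
have [M0 MD MZ] := sM.
(* Otherwise M + L a still avoids [r] and is strictly larger than M. *)
have dec a : exists x, M (a - f x * r).
  apply: contrapT => aM; pose N : set A := fun b => exists x, M (b - f x * a).
  have MN b : M b -> N b by exists 0; rewrite rmorph0 mul0r subr0.
  apply: (Mmax N).
    split=> // /(_ a) NM; apply: aM; exists 0; rewrite rmorph0 mul0r subr0.
    by apply: NM; exists 1; rewrite rmorph1 mul1r subrr.
  right; split; first split.
  - exact: MN.
  - move=> b c [x Mb] [y Mc]; exists (x + y).
    by rewrite rmorphD mulrDl opprD addrACA; apply: MD.
  - move=> l b [x Mb]; exists (l * x); rewrite rmorphM -mulrA -mulrBr.
    exact: MZ.
  - by move=> b /UM/MN.
  move=> [x Mx]; have [x0|x0] := eqVneq x 0.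
    by apply: Mr; move: Mx; rewrite x0 rmorph0 mul0r subr0.
  apply: aM; exists x^-1.
  have -> : a - f x^-1 * r = f (- x^-1) * (r - f x * a); last exact: MZ.
  by rewrite rmorphN mulNr mulrBr mulrA -rmorphM mulVf // rmorph1 mul1r opprB.
have uniq a x y : M (a - f x * r) -> M (a - f y * r) -> x = y.
  move=> Mx My; apply/eqP; rewrite -subr_eq0; apply/negPn/negP => xy.
  apply: Mr; have := subspace_sub sM My Mx; rewrite opprB addrC addrA subrK.
  rewrite -mulrBl -rmorphB => /(MZ (x - y)^-1).
  by rewrite mulrA -rmorphM mulVf // rmorph1 mul1r.
have [phi phiE] := choice dec; exists phi; split.
- split=> [a b|l a].
    apply: uniq (phiE (a + b)) _; rewrite rmorphD mulrDl opprD addrACA.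
    exact: MD.
  apply: uniq (phiE (f l * a)) _; rewrite rmorphM -mulrA -mulrBr.
  exact: MZ.
- move=> a /UM Ma; apply: uniq (phiE a) _.
  by rewrite rmorph0 mul0r subr0.
- by apply: uniq (phiE r) _; rewrite rmorph1 mul1r subrr.
Qed.

(** Separate [b i] from the combinations whose i-th coefficient is zero. The functionals live on all
    of [A], not only on the span of [b]. *)
Lemma free_dual n (b : 'I_n -> A) : lin_indep f b ->
  exists phi : 'I_n -> A -> L, (forall i, linfunc f (phi i)) /\
    forall i j, phi i (b j) = (i == j)%:R.
Proof.
move=> fb; suff /choice[phi phiP] : forall i, exists phi,
    linfunc f phi /\ forall j, phi (b j) = (i == j)%:R.
  by exists phi; split=> i; case: (phiP i).
move=> i; pose U a := exists x : 'I_n -> L, x i = 0 /\ a = \sum_j f (x j) * b j.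
have [||phi [phiP phiU phib]] := @linfunc_sep U (b i).
- split=> [|a c [x [x0 ->]] [y [y0 ->]]|l a [x [x0 ->]]].
  + by exists (fun=> 0); split=> //; rewrite big1 // => j _; rewrite rmorph0 mul0r.
  + exists (fun j => x j + y j); split; first by rewrite x0 y0 addr0.
    by rewrite -big_split; apply: eq_bigr => j _ /=; rewrite rmorphD mulrDl.
  + exists (fun j => l * x j); split; first by rewrite x0 mulr0.
    by rewrite mulr_sumr; apply: eq_bigr => j _; rewrite rmorphM mulrA.
- move=> [x [x0 bE]]; have := free_coef fb (x := (1%:M : 'M_n) i) (y := x).
  rewrite sum_scalar1 => /(_ bE i); rewrite x0 mxE eqxx => /eqP.
  by rewrite oner_eq0.
exists phi; split=> // j; have [<- //|ij] := eqVneq i j.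
apply: phiU; exists ((1%:M : 'M_n) j); rewrite sum_scalar1; split=> //.
by rewrite mxE eq_sym (negPf ij).
Qed.

(** Such a phi is a linear retraction of the structure map [f]; the descent arguments contract with
    it. *)
Lemma linfunc_one : (1 : A) <> 0 -> exists2 phi, linfunc f phi & phi 1 = 1.
Proof.
move=> A1; have [||phi [phiP _ phi1]] := @linfunc_sep (fun a => a = 0) 1.
- by split=> // [a b -> ->|l a ->]; rewrite ?addr0 ?mulr0.
- exact: A1.
by exists phi.
Qed.
End Separation.

(** * Tensor products and linear functionals *)

Section TensorFunctional.
Context {L A B : comPzRingType} (f : {rmorphism L -> A}) (g : {rmorphism L -> B}).

(** The contractions psi (x) id and id (x) phi, with L acting on the remaining factor. *)
Definition tevl (psi : A -> L) : tensor f g -> B :=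
  tbil (fun a b => g (psi a) * b).
Definition tevr (phi : B -> L) : tensor f g -> A :=
  tbil (fun a b => a * f (phi b)).

Lemma tevl_bal psi : linfunc f psi -> balanced f g (fun a b => g (psi a) * b).
Proof.
move=> [psiD psiZ]; split=> [a a' b|a b b'|a l b].
- by rewrite psiD rmorphD mulrDl.
- by rewrite mulrDr.
- by rewrite mulrC mulrC [a * _]mulrC psiZ rmorphM mulrCA mulrA.
Qed.

Lemma tevr_bal phi : linfunc g phi -> balanced f g (fun a b => a * f (phi b)).
Proof.
move=> [phiD phiZ]; split=> [a a' b|a b b'|a l b].
- by rewrite mulrDl.
- by rewrite phiD rmorphD mulrDr.
- by rewrite phiZ rmorphM mulrA.
Qed.

Lemma tevlE psi a b : linfunc f psi -> tevl psi (tens f g a b) = g (psi a) * b.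
Proof. by move=> /tevl_bal H; apply: (tbilE H). Qed.
Lemma tevlD psi : linfunc f psi -> {morph tevl psi : x y / x + y}.
Proof. by move=> /tevl_bal H; apply: (tbilD H). Qed.
Lemma tevl0 psi : linfunc f psi -> tevl psi 0 = 0.
Proof. by move=> /tevl_bal H; apply: (tbil0 H). Qed.
Lemma tevl_sum psi (I : Type) (r : seq I) (F : I -> tensor f g) : linfunc f psi ->
  tevl psi (\sum_(i <- r) F i) = \sum_(i <- r) tevl psi (F i).
Proof. by move=> H; apply: (big_morph _ (tevlD H) (tevl0 H)). Qed.

Lemma tevrE phi a b : linfunc g phi -> tevr phi (tens f g a b) = a * f (phi b).
Proof. by move=> /tevr_bal H; apply: (tbilE H). Qed.
Lemma tevrD phi : linfunc g phi -> {morph tevr phi : x y / x + y}.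
Proof. by move=> /tevr_bal H; apply: (tbilD H). Qed.
Lemma tevr0 phi : linfunc g phi -> tevr phi 0 = 0.
Proof. by move=> /tevr_bal H; apply: (tbil0 H). Qed.

Lemma tevr_linfunc phi : linfunc g phi -> linfunc (tinl f g) (tevr phi).
Proof.
move=> phiP; split=> [|a]; first exact: tevrD.
elim/(@tens_ind _ _ _ f g)=> [|x y IH IH'|a' b].
- by rewrite mulr0 (tevr0 phiP) mulr0.
- by rewrite mulrDr !(tevrD phiP) IH IH' mulrDr.
- by rewrite tensM mul1r !(tevrE _ _ phiP) mulrA.
Qed.

Lemma tevl_inr psi b : linfunc f psi -> psi 1 = 1 -> tevl psi (tinr f g b) = b.
Proof. by move=> psiP psi1; rewrite tevlE // psi1 rmorph1 mul1r. Qed.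

(** Contraction with the retraction psi is a left inverse. *)
Lemma tinr_inj psi : linfunc f psi -> psi 1 = 1 -> injective (tinr f g).
Proof. by move=> psiP psi1; apply: can_inj (fun b => tevl_inr b psiP psi1). Qed.
End TensorFunctional.

Section TensorSpan.
Context {L : fieldType} {A B : comPzRingType}.
Variables (f : {rmorphism L -> A}) (g : {rmorphism L -> B}).

Lemma tens_span_l (x : tensor f g) n (c : 'I_n -> A) :
  (forall p, p \in trep x -> inspan f c p.1) ->
  exists b, x = \sum_j tens f g (c j) (b j).
Proof.
(* Only the [x] of the conclusion is unfolded, so that hypothesis and conclusion speak of the same
   formal sum and the induction runs over it. *)
rewrite -{2}(trepK x); elim: (trep x) => [|[a b] s IH] cs.
  exists (fun=> 0); rewrite big1 // => j _; exact: tens0r.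
have [|b' sE] := IH; first by move=> p ps; apply: cs; rewrite inE ps orbT.
have [y /= aE] := cs (a, b) (mem_head _ _).
exists (fun j => g (y j) * b + b' j); rewrite tcls_sum big_cons -tcls_sum sE /= aE.
under [RHS]eq_bigr => j _ do rewrite tensDr -tens_bal mulrC.
rewrite big_split; congr (_ + _).
by rewrite (big_morph (fun z => tens f g z b) (fun u v => tensDl f g u v b) (tens0l f g b)).
Qed.

Lemma tens_span_r (x : tensor f g) n (c : 'I_n -> B) :
  (forall p, p \in trep x -> inspan g c p.2) ->
  exists a, x = \sum_j tens f g (a j) (c j).
Proof.
rewrite -{2}(trepK x); elim: (trep x) => [|[a b] s IH] cs.
  exists (fun=> 0); rewrite big1 // => j _; exact: tens0l.
have [|a' sE] := IH; first by move=> p ps; apply: cs; rewrite inE ps orbT.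
have [y /= bE] := cs (a, b) (mem_head _ _).
exists (fun j => a * f (y j) + a' j); rewrite tcls_sum big_cons -tcls_sum sE /= bE.
under [RHS]eq_bigr => j _ do rewrite tensDl tens_bal.
rewrite big_split; congr (_ + _).
by rewrite (big_morph (fun z => tens f g a z) (fun u v => tensDr f g a u v) (tens0r f g a)).
Qed.

Lemma tens_free_l (x : tensor f g) :
  exists n (c : 'I_n -> A) b, lin_indep f c /\ x = \sum_j tens f g (c j) (b j).
Proof.
have [n [c [fc cs]]] := seq_basis f [seq p.1 | p <- trep x].
have [|b xE] := @tens_span_l x n c; first by move=> p px; apply: cs; apply: map_f.
by exists n, c, b.
Qed.

Lemma tevl_dual n (c : 'I_n -> A) (b : 'I_n -> B) (psi : 'I_n -> A -> L) i :
  (forall i, linfunc f (psi i)) -> (forall i j, psi i (c j) = (i == j)%:R) ->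
  tevl (psi i) (\sum_j tens f g (c j) (b j)) = b i.
Proof.
move=> psiP dual; rewrite tevl_sum //.
under eq_bigr => j _ do rewrite tevlE // dual.
rewrite (bigD1 i) //= eqxx rmorph1 mul1r big1 ?addr0 // => j.
by rewrite eq_sym => /negPf->; rewrite rmorph0 mul0r.
Qed.

Lemma tens_eq0_free n (c : 'I_n -> A) (b : 'I_n -> B) : lin_indep f c ->
  \sum_j tens f g (c j) (b j) = 0 -> forall j, b j = 0.
Proof.
move=> /free_dual[psi [psiP dual]] E j.
by rewrite -(tevl_dual b j psiP dual) E tevl0.
Qed.
End TensorSpan.

(** * Coefficients in S of the elements of S (x)_K K[G] *)

Section Coefficients.
Context {K : fieldType} {G : linAlgGroup K} {L : diffFieldType}
  {k : {dmorphism triv K -> L}} {S : comPzRingType} (e : {rmorphism L -> S}).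
Local Notation T := (tensor e (galg G k)).

(** The element 1 (x) c of S (x)_K K[G], written in S (x)_L (L (x)_K K[G]). *)
Definition gel (c : grp_ring G) : T :=
  tinr e (galg G k) (tinr k (trivm (grp_alg G)) c).

(* id (x) phi : S (x)_L L[G] = S (x)_K K[G] -> S *)
Definition ev (phi : grp_ring G -> K) : T -> S :=
  @tevr _ _ _ e (galg G k) (@tevr (triv K) _ (triv (grp_ring G)) k (trivm (grp_alg G)) phi).

Section Ev.
Context {phi : grp_ring G -> K} (phiP : linfunc (grp_alg G) phi).

Let gevP : linfunc (galg G k) (@tevr (triv K) _ (triv (grp_ring G)) k (trivm (grp_alg G)) phi) :=
  @tevr_linfunc (triv K) L (triv (grp_ring G)) k (trivm (grp_alg G)) phi phiP.

Lemma ev_linfunc : linfunc (tinl e (galg G k)) (ev phi).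
Proof. exact: (tevr_linfunc e gevP). Qed.

Lemma evD : {morph ev phi : x y / x + y}. Proof. exact: ev_linfunc.1. Qed.
Lemma evZ s x : ev phi (tinl e (galg G k) s * x) = s * ev phi x.
Proof. exact: ev_linfunc.2. Qed.
Lemma evB x y : ev phi (x - y) = ev phi x - ev phi y.
Proof. by apply/eqP; rewrite eq_sym subr_eq -evD subrK. Qed.

Lemma ev_gel c : ev phi (gel c) = e (k (phi c)).
Proof.
rewrite [LHS](tevrE e _ _ gevP) mul1r; congr (e _).
rewrite [LHS](@tevrE (triv K) _ (triv (grp_ring G)) k (trivm (grp_alg G)) _ _ _ phiP).
by rewrite mul1r.
Qed.

Lemma ev_comb n (u : 'I_n -> S) (w : 'I_n -> grp_ring G) :
  ev phi (\sum_j tinl e (galg G k) (u j) * gel (w j)) =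
  \sum_j u j * e (k (phi (w j))).
Proof.
rewrite (linfunc_comb ev_linfunc); apply: eq_bigr => j _.
by rewrite ev_gel.
Qed.
End Ev.

Lemma gel_comb n (x : 'I_n -> K) (w : 'I_n -> grp_ring G) :
  gel (\sum_j grp_alg G (x j) * w j) =
  \sum_j tinl e (galg G k) (e (k (x j))) * gel (w j).
Proof.
rewrite /gel.
have E (I : finType) (F : I -> grp_ring G) : tinr k (trivm (grp_alg G)) (\sum_i F i) =
  \sum_i tinr k (trivm (grp_alg G)) (F i).
  exact: (rmorph_sum (tinr k (trivm (grp_alg G)))).
rewrite E rmorph_sum; apply: eq_bigr => j _.
rewrite tinlr -rmorphM; congr (tinr _ _ _).
by rewrite [galg G k _](tinlr k (trivm (grp_alg G)) (x j)) -rmorphM.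
Qed.

(** Only finitely many elements of K[G] occur in [t]. Quantifying over every [w] whose span contains
    them allows one independent [w] to be chosen later for several elements at once. *)
Lemma coef_support (t : T) : exists r : seq (grp_ring G),
  forall n (w : 'I_n -> grp_ring G),
    (forall c, c \in r -> inspan (grp_alg G) w c) ->
    exists u : 'I_n -> S, t = \sum_j tinl e (galg G k) (u j) * gel (w j).
Proof.
pose supp (t : T) := exists r : seq (grp_ring G), forall n (w : 'I_n -> grp_ring G),
  (forall c, c \in r -> inspan (grp_alg G) w c) ->
  exists u : 'I_n -> S, t = \sum_j tinl e (galg G k) (u j) * gel (w j).
have suppD x y : supp x -> supp y -> supp (x + y).
  move=> [r1 H1] [r2 H2]; exists (r1 ++ r2) => n w H.
  have [|u1 ->] := H1 n w; first by move=> c rc; apply: H; rewrite mem_cat rc.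
  have [|u2 ->] := H2 n w; first by move=> c rc; apply: H; rewrite mem_cat rc orbT.
  exists (fun j => u1 j + u2 j); rewrite -big_split; apply: eq_bigr => j _ /=.
  by rewrite rmorphD mulrDl.
have supp0 : supp 0.
  by exists [::] => n w _; exists (fun=> 0); rewrite big1 // => j _; rewrite rmorph0 mul0r.
move: t; apply: (tens_ind (P := supp)) => // s.
apply: (tens_ind (P := fun z => supp (tens e (galg G k) s z))) => [|x y Hx Hy|a c].
- by rewrite tens0r.
- by rewrite tensDr; apply: suppD.
exists [:: c] => n w /(_ c (mem_head _ _))[x cE].
exists (fun j => s * e a * e (k (x j))).
have -> : tens e (galg G k) s (tens k (trivm (grp_alg G)) a c) =
    tinl e (galg G k) (s * e a) * gel c.
  rewrite tensM mulr1 mul1r tens_bal; congr (tens _ _ s _).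
  by rewrite [RHS]tensM mulr1 mul1r.
rewrite cE gel_comb mulr_sumr; apply: eq_bigr => j _.
by rewrite mulrA -rmorphM.
Qed.

(** Over an independent [w], the functionals dual to [w] read off the coefficients of [t]. *)
Lemma coef_sep (t : T) :
  (forall phi, linfunc (grp_alg G) phi -> ev phi t = 0) -> t = 0.
Proof.
move=> t0; have [r rt] := coef_support t.
have [n [w [fw rw]]] := seq_basis (grp_alg G) r.
have [u tE] := rt n w rw; have [phi [phiP dual]] := free_dual fw.
rewrite tE big1 // => j _; suff -> : u j = 0 by rewrite rmorph0 mul0r.
have := t0 _ (phiP j); rewrite tE ev_comb // (bigD1 j) //= dual eqxx !rmorph1 mulr1.
rewrite big1 ?addr0 // => i; rewrite eq_sym dual => /negPf->.
by rewrite !rmorph0 mulr0.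
Qed.

Lemma coef_eq (t t' : T) :
  (forall phi, linfunc (grp_alg G) phi -> ev phi t = ev phi t') -> t = t'.
Proof.
move=> E; apply/eqP; rewrite -subr_eq0; apply/eqP; apply: coef_sep => phi phiP.
by rewrite evB // E // subrr.
Qed.
End Coefficients.

Section CoefficientsMap.
Context {K : fieldType} {G : linAlgGroup K} {L L' : diffFieldType}
  {k : {dmorphism triv K -> L}} {k' : {dmorphism triv K -> L'}}
  {S S' : comPzRingType} {e : {rmorphism L -> S}} {e' : {rmorphism L' -> S'}}.
Variables (l : {dmorphism L -> L'}) (lk : forall c, l (k c) = k' c)
  (u : {rmorphism S -> S'}) (ue : forall a, u (e a) = e' (l a)).

Local Notation M := (tmap u (gmap l) : tensor e (galg G k) -> tensor e' (galg G k')).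

Lemma gmap_rmorph : {h : {rmorphism gcoord G k -> gcoord G k'} | h =1 gmap l}.
Proof. by exists (gmap_dmorph G lk). Qed.

Lemma cmap_rmorph :
  {h : {rmorphism tensor e (galg G k) -> tensor e' (galg G k')} |
    [/\ h =1 M, forall s, h (tinl e (galg G k) s) = tinl e' (galg G k') (u s) &
        forall c, h (tinr e (galg G k) c) = tinr e' (galg G k') (gmap l c)]}.
Proof.
have [h hE] := gmap_rmorph.
have -> : gmap l = h :> (gcoord G k -> gcoord G k') by apply/funext => x; rewrite hE.
have vE a : h (galg G k a) = galg G k' (l a).
  rewrite hE; exact: (tlift_inl (gmap_compat G lk)).
have C a : (tinl e' (galg G k') \o u) (e a) = (tinr e' (galg G k') \o h) (galg G k a).
  exact: tmap_compat.
have [w wE] := tlift_rmorph C; exists w; split=> // x; rewrite wE.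
  exact: (tlift_inl C).
exact: (tlift_inr C).
Qed.

Lemma cmap_gel c : M (gel e c) = gel e' c.
Proof.
have [h [<- _ ->]] := cmap_rmorph; congr (tinr _ _ _).
exact: (tlift_inr (gmap_compat G lk)).
Qed.

(** Since phi is defined over K, taking coefficients commutes with semilinear changes of S and L; it
    is enough to check this on sums of u_j (x) w_j. *)
Lemma ev_cmap phi t : linfunc (grp_alg G) phi -> ev phi (M t) = u (ev phi t).
Proof.
move=> phiP; have [r rt] := coef_support t.
have [n [w rw]] := seq_span (grp_alg G) r.
have [x ->] := rt n w rw; rewrite ev_comb // rmorph_sum.
have [h [hE hl _]] := cmap_rmorph.
rewrite -hE rmorph_sum.
under eq_bigr => j _ do rewrite rmorphM hl [X in _ * X]hE cmap_gel.
by rewrite ev_comb //; apply: eq_bigr => j _; rewrite rmorphM ue lk.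
Qed.
End CoefficientsMap.

(** * Coefficient spaces of a torsor *)

Section IsotypicPart.
Context {K : fieldType} {G : linAlgGroup K} {L : diffFieldType}
  {k : {dmorphism triv K -> L}} (X : diffGAlg G k).
Local Notation e := (dga_alg X).
Local Notation inlX := (tinl e (galg G k)).

(* The elements s of X with rho(s) in X (x)_K W, where W is the span of w. *)
Definition coef_in n (w : 'I_n -> grp_ring G) (s : X) : Prop :=
  exists u : 'I_n -> X, coact X s = \sum_j inlX (u j) * gel e (w j).

Lemma coef_in_subspace n (w : 'I_n -> grp_ring G) : subspace e (coef_in w).
Proof.
split=> [|s t [u su] [v tv]|a s [u su]].
- by exists (fun=> 0); rewrite rmorph0 big1 // => j _; rewrite rmorph0 mul0r.
- exists (fun j => u j + v j); rewrite rmorphD /= su tv -big_split.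
  by apply: eq_bigr => j _; rewrite /= rmorphD mulrDl.
- exists (fun j => e a * u j); rewrite rmorphM /= su (coact_alg (coactP X)) mulr_sumr.
  by apply: eq_bigr => j _; rewrite rmorphM mulrA.
Qed.

Lemma coef_in_support (s : X) : exists r : seq (grp_ring G),
  forall n (w : 'I_n -> grp_ring G),
    (forall c, c \in r -> inspan (grp_alg G) w c) -> coef_in w s.
Proof. exact: coef_support. Qed.

(** The coefficients along [w] can only be those given by the dual functionals. Membership thus
    becomes a system of L-linear equations in [s], a form that can be carried through a base
    change. *)
Lemma coef_inE n (w : 'I_n -> grp_ring G) (phi : 'I_n -> grp_ring G -> K) (s : X) :
  (forall i, linfunc (grp_alg G) (phi i)) ->
  (forall i j, phi i (w j) = (i == j)%:R) ->
  coef_in w s <-> forall psi, linfunc (grp_alg G) psi ->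
    ev psi (coact X s) = \sum_j ev (phi j) (coact X s) * e (k (psi (w j))).
Proof.
move=> phiP dual; split=> [[u E] psi psiP|E].
  rewrite E ev_comb //; apply: eq_bigr => j _.
  rewrite ev_comb // (bigD1 j) //= dual eqxx !rmorph1 mulr1 big1 ?addr0 // => i.
  by rewrite dual eq_sym => /negPf->; rewrite !rmorph0 mulr0.
exists (fun j => ev (phi j) (coact X s)); apply: coef_eq => psi psiP.
by rewrite E // ev_comb.
Qed.

(* The torsor structure provides g : K[G] -> X (x) X with
   1 (x) s = sum_j (u_j (x) 1) g(w_j); a functional on the left factor then
   expresses s through the right components of the g(w_j). *)
Lemma coef_in_finite n (w : 'I_n -> grp_ring G) : is_torsor X ->
  exists m (c : 'I_m -> X), forall s, coef_in w s -> inspan e c s.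
Proof.
move=> [X1 _ tX]; pose h : {rmorphism L -> tensor e e} := tinl e e \o e.
have xP a : (tinl e e : {rmorphism X -> tensor e e}) (e a) = h a by [].
have yP a : (tinr e e : {rmorphism X -> tensor e e}) (e a) = h a.
  by rewrite /h /= tinlr.
pose x : alghom e h := AlgHom xP; pose y : alghom e h := AlgHom yP.
have [g [gE _]] := tX _ h x y.
have [W [WE Wl Wr]] := act_hom0 g x; have [v [vE _ vr]] := gpt_hom g.
have Wgel c : W (gel e c) = g c by rewrite Wr -vE vr.
have [lam lamP lam1] := linfunc_one e X1.
have [m [c cP]] := seq_span e
  (flatten [seq [seq p.2 | p <- trep (g (w j))] | j <- enum 'I_n]).
exists m, c => s [u su].
have E : tinr e e s = \sum_j tinl e e (u j) * g (w j).
  have := gE s; rewrite /= => ->; rewrite /act /= -WE su rmorph_sum.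
  by apply: eq_bigr => j _; rewrite rmorphM Wl Wgel.
rewrite -(tevl_inr e s lamP lam1) E tevl_sum //.
have [S0 SD SZ] := inspan_subspace e c.
elim/big_ind: _ => // j _; rewrite [g (w j)]tens_repE mulr_sumr tevl_sum //.
rewrite big_seq; elim/big_ind: _ => // -[a b] ab; rewrite /= tensM mul1r tevlE //.
apply: SZ; apply: cP; apply/flattenP.
exists [seq p.2 | p <- trep (g (w j))]; last by apply: (map_f snd ab).
by apply: map_f; rewrite mem_enum.
Qed.
End IsotypicPart.

(** * Base change of coefficient spaces *)

Section BaseChangeMor.
Context {K : fieldType} {G : linAlgGroup K} {L L' : diffFieldType}
  {k : {dmorphism triv K -> L}} {k' : {dmorphism triv K -> L'}}
  {l : {dmorphism L -> L'}} {lk : forall c, l (k c) = k' c}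
  {X : diffGAlg G k} {X' : diffGAlg G k'}.
Variable th : diffGIso (base_change lk X) X'.

(** The semilinear map X -> X' that determines [th]. The patching data and the components of a
    solution are both handled in this form. *)
Definition bc_mor : {dmorphism X -> X'} := th \o tinr l (dga_alg X).
Local Notation m := bc_mor.

Let th_alg a : th (tens l (dga_alg X) a 1) = dga_alg X' a := iso_alg th a.

Lemma bc_mor_alg a : m (dga_alg X a) = dga_alg X' (l a).
Proof. rewrite -[RHS](iso_alg th); congr (th _); exact/esym/tinlr. Qed.

Lemma bc_mor_scale a s : m (dga_alg X a * s) = dga_alg X' (l a) * m s.
Proof. by rewrite -bc_mor_alg -rmorphM. Qed.

Lemma bc_mor_tens a s : th (tens l (dga_alg X) a s) = dga_alg X' a * m s.
Proof. by rewrite tens_split rmorphM /= th_alg. Qed.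

Lemma bc_mor_coact s : coact X' (m s) = tmap m (gmap l) (coact X s).
Proof.
rewrite [LHS](iso_coact th).
have C a : (tinl (dga_alg X') (galg G k') \o th) (tinl l (dga_alg X) a) =
           (tinr (dga_alg X') (galg G k') \o idfun) (galg G k' a).
  by rewrite /= th_alg tinlr.
have [H HE] := tlift_rmorph C.
have [h [hE hl hr]] := cmap_rmorph (G := G) lk bc_mor_alg.
rewrite -hE -[LHS]HE.
have -> : coact (base_change lk X) (tinr l (dga_alg X) s) =
          tlift_dmorph (bc_compat1 lk X) (coact X s).
  exact: (tlift_inr (bc_compat2 lk X)).
have E : H \o tlift_dmorph (bc_compat1 lk X) =1 h.
  apply: tens_eq_hom => [a|c].
    rewrite hl; apply: etrans (congr1 H (tlift_inl (bc_compat1 lk X) a)) _.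
    by apply: etrans (HE _) _; apply: (tlift_inl C).
  rewrite hr; apply: etrans (congr1 H (tlift_inr (bc_compat1 lk X) c)) _.
  by apply: etrans (HE _) _; apply: (tlift_inr C).
exact: E.
Qed.

Lemma ev_bc_mor phi s : linfunc (grp_alg G) phi ->
  ev phi (coact X' (m s)) = m (ev phi (coact X s)).
Proof. by move=> phiP; rewrite bc_mor_coact (ev_cmap lk bc_mor_alg). Qed.

Lemma coef_in_mor n (w : 'I_n -> grp_ring G) s : coef_in w s -> coef_in w (m s).
Proof.
move=> [u su]; have [h [hE hl _]] := cmap_rmorph (G := G) lk bc_mor_alg.
exists (fun j => m (u j)); rewrite bc_mor_coact su -hE rmorph_sum.
apply: eq_bigr => j _; rewrite rmorphM hl [X in _ * X]hE.
by rewrite (cmap_gel lk bc_mor_alg).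
Qed.

Lemma bc_mor_comb n (a : 'I_n -> L') (s : 'I_n -> X) :
  th (\sum_q tens l (dga_alg X) (a q) (s q)) = \sum_q dga_alg X' (a q) * m (s q).
Proof. by rewrite rmorph_sum; apply: eq_bigr => q _; apply: bc_mor_tens. Qed.

(** A relation in X' comes from a vanishing sum of x_j (x) b_j, whose coefficients are recovered by
    functionals dual to [b]. *)
Lemma bc_mor_indep n (b : 'I_n -> X) :
  lin_indep (dga_alg X) b -> lin_indep (dga_alg X') (m \o b).
Proof.
move=> fb x; rewrite -bc_mor_comb -(rmorph0 th) => /(bij_inj (iso_bij th)) E j.
have [phi [phiP dual]] := free_dual fb.
have := congr1 (@tevr _ _ _ l (dga_alg X) (phi j)) E.
rewrite tevr0 // (linfunc_sum (tevr_linfunc l (phiP j))).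
under eq_bigr => i _ do rewrite tevrE // dual.
rewrite (bigD1 j) //= eqxx rmorph1 mulr1 big1 ?addr0 // => i.
by rewrite eq_sym => /negPf->; rewrite rmorph0 mulr0.
Qed.

(** Write y as the sum of a_q m(s_q) with the a_q in L' independent over L. The equations of
    [coef_inE] have coefficients in L, so the equation for y splits into one equation for each
    s_q. *)
Lemma coef_in_mor_span n (w : 'I_n -> grp_ring G) y :
  lin_indep (grp_alg G) w -> coef_in w y ->
  exists p (a : 'I_p -> L') (s : 'I_p -> X),
    (forall q, coef_in w (s q)) /\ y = \sum_q dga_alg X' (a q) * m (s q).
Proof.
move=> fw; have [phi [phiP dual]] := free_dual fw.
move=> /(coef_inE _ phiP dual) yE.
have [z zE] : exists z, th z = y.
  by have [z _ zK] := iso_bij th; exists (z y).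
have [p [a [s [fa E]]]] := tens_free_l (z : tensor l (dga_alg X)).
have yE' : y = \sum_q dga_alg X' (a q) * m (s q) by rewrite -zE E bc_mor_comb.
exists p, a, s; split=> // q; apply/(coef_inE _ phiP dual) => psi psiP.
have evy chi : linfunc (grp_alg G) chi ->
    ev chi (coact X' y) = \sum_q dga_alg X' (a q) * m (ev chi (coact X (s q))).
  move=> chiP; rewrite yE' rmorph_sum (linfunc_sum (ev_linfunc _ chiP)).
  apply: eq_bigr => i _; rewrite rmorphM /= (coact_alg (coactP X')) evZ //.
  by rewrite ev_bc_mor.
apply/eqP; rewrite -subr_eq0; apply/eqP; move: q.
(* Independence of the a_q leaves one identity in L' (x)_L X, which is tested in X' through the
   injective [th]; there it is the equation for y. *)
apply: (tens_eq0_free (f := l) (g := dga_alg X) fa).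
apply: (bij_inj (iso_bij th)); rewrite rmorph0 bc_mor_comb.
have mE i : m (ev psi (coact X (s i)) -
      \sum_j ev (phi j) (coact X (s i)) * dga_alg X (k (psi (w j)))) =
    m (ev psi (coact X (s i))) -
      \sum_j m (ev (phi j) (coact X (s i))) * dga_alg X' (k' (psi (w j))).
  rewrite (rmorphB m); congr (_ - _); rewrite (rmorph_sum m); apply: eq_bigr => j _.
  by rewrite -lk -bc_mor_alg; apply: (rmorphM m).
under eq_bigr => i _ do rewrite mE mulrBr mulr_sumr.
rewrite sumrB -evy // yE // exchange_big /=; apply/eqP; rewrite subr_eq0; apply/eqP.
apply: eq_bigr => j _; rewrite evy // mulr_suml; apply: eq_bigr => i _.
by rewrite mulrA.
Qed.

Lemma coef_in_mor_basis n (w : 'I_n -> grp_ring G) d (b : 'I_d -> X) :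
  lin_indep (grp_alg G) w -> is_basis (dga_alg X) (coef_in w) b ->
  is_basis (dga_alg X') (coef_in w) (m \o b).
Proof.
move=> fw [wb fb sb]; split=> [j||y /(coef_in_mor_span fw)[p [a [s [ws ->]]]]].
- exact: coef_in_mor.
- exact: bc_mor_indep.
apply: (inspan_trans (b := m \o s)); last by exists a.
move=> q; have [x sE] := sb _ (ws q); exists (l \o x).
rewrite [LHS](congr1 m sE) rmorph_sum; apply: eq_bigr => j _.
exact: bc_mor_scale.
Qed.
End BaseChangeMor.

(** * Descent of the co-action *)

Lemma inj_surj_bij (A B : Type) (f : A -> B) :
  injective f -> (forall b, exists a, f a = b) -> bijective f.
Proof.
move=> fI /choice[g fg]; exists g => // a; apply: fI; exact: fg.
Qed.

Lemma tlift_nat (L : Type) (A B T T' : comPzRingType) (f : L -> A) (g : L -> B)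
    (j : {rmorphism T -> T'}) (u : A -> T) (v : B -> T) (x : tensor f g) :
  j (tlift u v x) = tlift (j \o u) (j \o v) x.
Proof. by rewrite [LHS]rmorph_sum; apply: eq_bigr => i _; rewrite rmorphM. Qed.

Lemma pt_mul_nat (L : Type) (A R R' : comPzRingType) (f : L -> A)
    (D : A -> tensor f f) (j : {rmorphism R -> R'}) (x y : A -> R) :
  j \o pt_mul D x y = pt_mul D (j \o x) (j \o y).
Proof. by apply/funext => a; apply: tlift_nat. Qed.

Lemma act_nat (K : fieldType) (G : linAlgGroup K) (L : diffFieldType)
    (k : {dmorphism triv K -> L}) (S R R' : comPzRingType) (e : L -> S)
    (rho : S -> tensor e (galg G k)) (j : {rmorphism R -> R'})
    (h : L -> R) (x : S -> R) (g : grp_ring G -> R) :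
  j \o act rho h x g = act rho (j \o h) (j \o x) (j \o g).
Proof.
apply/funext => s; apply: etrans (tlift_nat _ _ _ _) _; congr (tlift _ _ _).
by apply/funext => c; apply: tlift_nat.
Qed.

Section Extension.
Context {K : fieldType} {G : linAlgGroup K} {L L' : diffFieldType}
  {k : {dmorphism triv K -> L}} {k' : {dmorphism triv K -> L'}}
  {l : {dmorphism L -> L'}} (lk : forall c, l (k c) = k' c)
  {S : comPzRingType} {e : {rmorphism L -> S}}
  (rho : {rmorphism S -> tensor e (galg G k)})
  (X' : diffGAlg G k') (p : {rmorphism S -> X'}).
Hypothesis rho_alg : forall a, rho (e a) = tinl e (galg G k) (e a).
Hypothesis p_alg : forall a, p (e a) = dga_alg X' (l a).
Hypothesis p_coact : forall s, coact X' (p s) = tmap p (gmap l) (rho s).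
Hypothesis p_bij : bijective (tlift (dga_alg X') p : tensor l e -> X').

Section Points.
Context {R : comPzRingType} {h : {rmorphism L' -> R}}.

Lemma restr_gpt_alg (g : alghom (grp_alg G) (h \o k')) c :
  (g : {rmorphism _ -> _}) (grp_alg G c) = ((h \o l) \o k) c.
Proof. by rewrite alghom_alg /= lk. Qed.
Definition restr_gpt (g : alghom (grp_alg G) (h \o k')) :
  alghom (grp_alg G) ((h \o l) \o k) := AlgHom (restr_gpt_alg g).

Lemma extd_gpt_alg (g : alghom (grp_alg G) ((h \o l) \o k)) c :
  (g : {rmorphism _ -> _}) (grp_alg G c) = (h \o k') c.
Proof. by rewrite alghom_alg /= lk. Qed.
Definition extd_gpt (g : alghom (grp_alg G) ((h \o l) \o k)) :
  alghom (grp_alg G) (h \o k') := AlgHom (extd_gpt_alg g).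

Lemma restr_pt_alg (x : alghom (dga_alg X') h) a :
  ((x : {rmorphism _ -> _}) \o p) (e a) = (h \o l) a.
Proof. by rewrite /= p_alg alghom_alg. Qed.
Definition restr_pt (x : alghom (dga_alg X') h) : alghom e (h \o l) :=
  AlgHom (restr_pt_alg x).

(** Through X' = L' (x)_L S, the structure map [h] and the point [x] together define a point of
    X'. *)
Lemma extd_pt (x : alghom e (h \o l)) :
  exists x' : alghom (dga_alg X') h, x' \o p = x.
Proof.
have C a : dga_alg X' (l a) = p (e a) by rewrite p_alg.
have [Q QE] := tlift_rmorph C.
have [Q' QK Q'K] : bijective Q := eq_bij p_bij (fun z => esym (QE z)).
pose Q'z := GRing.isZmodMorphism.Build _ _ _ (can2_zmod_morphism QK Q'K).
pose Q'm := GRing.isMonoidMorphism.Build _ _ _ (GRing.can2_monoid_morphism QK Q'K).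
pose Q'r : {rmorphism X' -> tensor l e} := HB.pack Q' Q'z Q'm.
have hx a : h (l a) = x (e a) by rewrite alghom_alg.
have [y yE] := tlift_rmorph hx.
have yP a : (y \o Q'r) (dga_alg X' a) = h a.
  rewrite /= -[dga_alg X' a](tlift_inl C) -QE [Q' _]QK yE.
  exact: (tlift_inl hx).
exists (AlgHom yP); apply/funext => s.
rewrite /= -[p s](tlift_inr C) -QE [Q' _]QK yE; exact: (tlift_inr hx).
Qed.

Lemma act_ext (x : alghom (dga_alg X') h) (g : alghom (grp_alg G) (h \o k')) :
  act (coact X') h x g \o p = act rho (h \o l) (x \o p) g.
Proof.
apply/funext => s.
have [W [WE Wl Wr]] := act_hom0 g x.
have [w [wE wl wr]] := gpt_hom g.
have [V [VE Vl Vr]] := act_hom0 (restr_gpt g) (restr_pt x).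
have [v [vE vl vr]] := gpt_hom (restr_gpt g).
have [m [mE ml mr]] := cmap_rmorph (G := G) lk p_alg.
rewrite /act /= -WE -[RHS]VE p_coact -mE.
have gm : w \o gmap_dmorph G lk =1 v.
  apply: tens_eq_hom => [a|c].
    apply: etrans (congr1 w (tlift_inl (gmap_compat G lk) a)) _.
    by rewrite [LHS]wl [RHS]vl.
  apply: etrans (congr1 w (tlift_inr (gmap_compat G lk) c)) _.
  by rewrite [LHS]wr [RHS]vr.
have E : W \o m =1 V.
  apply: tens_eq_hom => [a|c].
    by rewrite /= ml [LHS]Wl [RHS]Vl.
  rewrite /= mr [LHS]Wr [RHS]Vr -[LHS]wE -[RHS]vE; exact: gm.
exact: E.
Qed.
End Points.

(** Over an L'-algebra every point of S extends to X', and [act_ext] restricts the axioms known for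
    X' back to S. *)
Lemma coaction_ext (R : comPzRingType) (h : {rmorphism L' -> R})
    (x : alghom e (h \o l)) :
  act rho (h \o l) x ((h \o l) \o k \o counit G) = x /\
  forall g g' : alghom (grp_alg G) ((h \o l) \o k),
    act rho (h \o l) x (pt_mul (comul G) g g') =
    act rho (h \o l) (act rho (h \o l) x g) g'.
Proof.
have [x' <-] := extd_pt x; split=> [|g g'].
  have oneP c : (h \o k' \o counit G) (grp_alg G c) = (h \o k') c.
    by rewrite /= counit_alg.
  pose one : alghom (grp_alg G) (h \o k') :=
    AlgHom (alghom_fun := h \o k' \o counit G) oneP.
  have -> : (h \o l) \o k \o counit G = one.
    by apply/funext => c; rewrite /= lk.
  rewrite -act_ext; apply/funext => s; exact: (act_one (coactP X') x').
have [gg ggE] := pt_mul_hom (extd_gpt g) (extd_gpt g') (comul_alg G).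
have -> : pt_mul (comul G) g g' = gg by apply/funext => c; rewrite ggE.
have actE (y : alghom (dga_alg X') h) (f : alghom (grp_alg G) ((h \o l) \o k)) :
  act rho (h \o l) (y \o p) f = act (coact X') h y (extd_gpt f) \o p.
  by rewrite act_ext.
rewrite -act_ext actE.
have [z zE] := act_hom (extd_gpt g) x' (coact_alg (coactP X')).
have zE' : act (coact X') h x' (extd_gpt g) = z by apply/funext => c; rewrite zE.
rewrite zE' actE -zE'.
apply/funext => s /=.
have -> : (gg : _ -> _) = pt_mul (comul G) (extd_gpt g) (extd_gpt g').
  by apply/funext => c; rewrite ggE.
exact: (act_mul (coactP X') x').
Qed.

(* R embeds in the L'-algebra L' (x)_L R, over which points of S extend to X'. *)
Lemma coaction_descent : is_coaction rho.
Proof.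
have L1 : (1 : L') <> 0 by apply/eqP/oner_neq0.
have [psi psiP psi1] := linfunc_one l L1.
have key (R : comPzRingType) (h : {rmorphism L -> R}) (x : alghom e h) :
  act rho h x (h \o k \o counit G) = x /\
  forall g g' : alghom (grp_alg G) (h \o k),
    act rho h x (pt_mul (comul G) g g') = act rho h (act rho h x g) g'.
  pose j : {rmorphism R -> tensor l h} := tinr l h.
  pose h' : {rmorphism L' -> tensor l h} := tinl l h.
  have jI (f f' : S -> R) : j \o f = j \o f' -> f = f'.
    move=> E; apply/funext => s; apply: (tinr_inj psiP psi1).
    exact: (congr1 (fun f => f s) E).
  have jh : j \o h = h' \o l by apply/funext => a; rewrite /= [RHS]tinlr.
  have jxP a : (j \o (x : {rmorphism _ -> _})) (e a) = (h' \o l) a.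
    by rewrite -jh /= alghom_alg.
  have jgP (g : alghom (grp_alg G) (h \o k)) c :
      (j \o (g : {rmorphism _ -> _})) (grp_alg G c) = ((h' \o l) \o k) c.
    by rewrite -jh /= alghom_alg.
  have [E1 E2] := coaction_ext (AlgHom jxP); split=> [|g g'].
    apply: jI; rewrite act_nat -[X in act _ _ _ X = _]/((j \o h) \o k \o counit G) jh.
    exact: E1.
  apply: jI; rewrite !act_nat pt_mul_nat jh.
  exact: E2 (AlgHom (jgP g)) (AlgHom (jgP g')).
split=> // [R h x s|R h x g g' s]; have [E1 E2] := key R h x.
  by rewrite E1.
by rewrite E2.
Qed.
End Extension.

(** * Descent of the torsor property *)

Section TorsorDescent.
Context {K : fieldType} {G : linAlgGroup K} {L L' : diffFieldType}
  {k : {dmorphism triv K -> L}} {k' : {dmorphism triv K -> L'}}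
  {l : {dmorphism L -> L'}} (lk : forall c, l (k c) = k' c)
  {X : diffGAlg G k} {X' : diffGAlg G k'} (p : {rmorphism X -> X'}).
Local Notation e := (dga_alg X).
Hypothesis p_alg : forall a, p (e a) = dga_alg X' (l a).
Hypothesis p_coact : forall s, coact X' (p s) = tmap p (gmap l) (coact X s).
Hypothesis p_bij : bijective (tlift (dga_alg X') p : tensor l e -> X').

Definition simply_transitive_on (R : comPzRingType) (h : {rmorphism L -> R}) :=
  forall x y : alghom e h, exists g : alghom (grp_alg G) (h \o k),
    (forall s, y s = act (coact X) h x g s) /\
    forall g' : alghom (grp_alg G) (h \o k),
      (forall s, y s = act (coact X) h x g' s) -> g' =1 g.

Lemma simply_transitive_ext (R : comPzRingType) (h : {rmorphism L' -> R}) :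
  is_torsor X' -> simply_transitive_on (h \o l).
Proof.
move=> [_ _ tX'] x y.
have [x' xE] := extd_pt p_alg p_bij x; have [y' yE] := extd_pt p_alg p_bij y.
have [g [gE gU]] := tX' R h x' y'.
exists (restr_gpt lk g); split=> [s|g' g'E].
  rewrite -[in RHS]xE -[LHS](congr1 (fun f => f s) yE) /= gE.
  exact: (congr1 (fun f => f s) (act_ext lk p_alg p_coact x' g)).
apply: (gU (extd_gpt lk g')) => t.
have actx : act (coact X') h x' (extd_gpt lk g') \o p = y.
  by rewrite (act_ext lk p_alg p_coact) xE; apply/funext => s; rewrite g'E.
have [z zE] := act_hom (extd_gpt lk g') x' (coact_alg (coactP X')).
rewrite -zE; have C a : dga_alg X' (l a) = p (e a) by rewrite p_alg.
have [Q QE] := tlift_rmorph C; have [Q' _ Q'K] := p_bij.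
rewrite -(Q'K t) -QE.
(* Uniqueness is known for points of X', so agreement on S must be raised to X'; both points also
   agree on L', and L' and S generate L' (x)_L S. *)
have E : y' \o Q =1 z \o Q.
  apply: tens_eq_hom => [a|s]; rewrite /= QE.
    by rewrite (tlift_inl C) !alghom_alg.
  rewrite (tlift_inr C) zE; apply: etrans (congr1 (fun f => f s) yE) _.
  by rewrite -actx.
exact: E.
Qed.

(* The point over L' (x)_L R is unique, hence equalizes the two maps to
   L' (x)_L L' (x)_L R, so it takes values in R. *)
Lemma simply_transitive_descent (R : comPzRingType) (h : {rmorphism L -> R}) :
  is_torsor X' -> simply_transitive_on h.
Proof.
move=> tX' x y.
have L1 : (1 : L') <> 0 by apply/eqP/oner_neq0.
have [psi psiP psi1] := linfunc_one l L1.
pose j : {rmorphism R -> tensor l h} := tinr l h.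
pose h1 : {rmorphism L' -> tensor l h} := tinl l h.
have jI : injective j := tinr_inj psiP psi1.
have jh : h1 \o l = j \o h by apply/funext => a; rewrite /= [LHS]tinlr.
have jxP (z : alghom e h) a :
    (j \o (z : {rmorphism _ -> _})) (e a) = (h1 \o l) a.
  by rewrite jh /= alghom_alg.
have [g1 [g1E g1U]] := simply_transitive_ext tX' (AlgHom (jxP x)) (AlgHom (jxP y)).
rewrite /= in g1E g1U.
pose j2 : {rmorphism tensor l h -> tensor l (j \o h)} := tinr l (j \o h).
pose h2 : {rmorphism L' -> tensor l (j \o h)} := tinl l (j \o h).
have C a : h2 (l a) = (j2 \o j) (h a) by rewrite /= [LHS]tinlr.
(* [j2] and [i2] are the two maps L' (x) R -> L' (x) (L' (x) R): a (x) r goes to 1 (x) (a (x) r)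
   under [j2] and to a (x) (1 (x) r) under [i2]. *)
have [i2 i2E] := tlift_rmorph C.
have i2j : i2 \o j = j2 \o j.
  by apply/funext => r; rewrite /= i2E (tlift_inr C).
have h2l : h2 \o l = j2 \o (h1 \o l).
  by apply/funext => a; rewrite jh /= C.
have jjxP (z : alghom e h) a :
    (j2 \o j \o (z : {rmorphism _ -> _})) (e a) = (h2 \o l) a.
  by rewrite h2l jh /= alghom_alg.
have [g2 [_ g2U]] := simply_transitive_ext tX' (AlgHom (jjxP x)) (AlgHom (jjxP y)).
have j2gP c : (j2 \o (g1 : {rmorphism _ -> _})) (grp_alg G c) = ((h2 \o l) \o k) c.
  by rewrite h2l /= alghom_alg.
have i2gP c : (i2 \o (g1 : {rmorphism _ -> _})) (grp_alg G c) = ((h2 \o l) \o k) c.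
  rewrite h2l /= alghom_alg; have := congr1 (fun f => f (k c)) jh => /= ->.
  exact: (congr1 (fun f => f _) i2j).
have actg : act (coact X) (h1 \o l) (j \o x) g1 = j \o y.
  by apply/funext => s; rewrite -[LHS]g1E.
have actj : act (coact X) (h2 \o l) (j2 \o j \o x) (j2 \o g1) = j2 \o j \o y.
  by rewrite h2l -[RHS]/(j2 \o (j \o y)) -actg act_nat.
have acti : act (coact X) (h2 \o l) (j2 \o j \o x) (i2 \o g1) = j2 \o j \o y.
  have -> : h2 \o l = i2 \o (h1 \o l) by rewrite h2l jh -[LHS]/((j2 \o j) \o h) -i2j.
  by rewrite -i2j -[RHS]/(i2 \o (j \o y)) -actg act_nat.
(* Both images of [g1] carry the image of x to that of y, so both equal the unique point [g2]. *)
have E c : j2 (g1 c) = i2 (g1 c).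
  apply: etrans (g2U (AlgHom j2gP) _ c) _ => [s|].
    by rewrite /= actj.
  by apply: esym; apply: etrans (g2U (AlgHom i2gP) _ c) _ => [s|//]; rewrite /= acti.
(* Contracting the outer L' turns [j2 (g1 c)] into [g1 c] and [i2 (g1 c)] into [j (g0 c)]; their
   equality shows that [g1] takes values in R. *)
pose g0 c := tevl psi (g1 c).
have tevi t : tevl (f := l) (g := j \o h) psi (i2 t) = j (tevl psi t).
  elim/(@tens_ind _ _ _ l h): t => [|t t' IH IH'|a r].
  - by rewrite rmorph0 !tevl0 // rmorph0.
  - by rewrite rmorphD !tevlD // rmorphD IH IH'.
  rewrite i2E (tliftE C) tensM mulr1 mul1r !tevlE //.
  by rewrite -[RHS]/(j _) rmorphM.
have jg0 c : j (g0 c) = g1 c.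
  by rewrite -tevi -E; apply: (@tevl_inr _ _ _ l (j \o h)).
have g0z : zmod_morphism g0 by move=> a b; apply: jI; rewrite rmorphB !jg0 rmorphB.
have g0m : monoid_morphism g0.
  split=> [|a b]; apply: jI; first by rewrite jg0 !rmorph1.
  by rewrite (rmorphM j) !jg0 rmorphM.
pose g0r : {rmorphism grp_ring G -> R} := HB.pack g0
  (GRing.isZmodMorphism.Build _ _ _ g0z) (GRing.isMonoidMorphism.Build _ _ _ g0m).
have g0P c : g0r (grp_alg G c) = (h \o k) c.
  apply: jI; rewrite [LHS]jg0 alghom_alg.
  exact: (congr1 (fun f => f (k c)) jh).
exists (AlgHom g0P); split=> [s|g' g'E d].
  apply: jI; rewrite -[LHS](congr1 (fun f => f s) actg) jh.
  have -> : (g1 : _ -> _) = j \o g0 by apply/funext => c; rewrite /= jg0.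
  exact/esym/(congr1 (fun f => f s) (act_nat (coact X) j h x g0)).
have jg'P c : (j \o (g' : {rmorphism _ -> _})) (grp_alg G c) = ((h1 \o l) \o k) c.
  by rewrite jh /= alghom_alg.
apply: jI; rewrite [RHS]jg0; apply: (g1U (AlgHom jg'P)) => s /=.
rewrite g'E jh; exact: (congr1 (fun f => f s) (act_nat (coact X) j h x g')).
Qed.

(** The right components of tensors representing the generators of X' generate X. The images of
    tensors with right components in U form a subalgebra containing those generators, hence all of
    X'; contraction with psi brings 1 (x) s back to s in U. *)
Lemma finite_type_descent : finite_type (dga_alg X') -> finite_type e.
Proof.
move=> [r rP].
have L1 : (1 : L') <> 0 by apply/eqP/oner_neq0.
have [psi psiP psi1] := linfunc_one l L1.
have C a : dga_alg X' (l a) = p (e a) by rewrite p_alg.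
have [Q QE] := tlift_rmorph C.
have [Q' QK Q'K] : bijective Q := eq_bij p_bij (fun z => esym (QE z)).
exists (flatten [seq [seq q.2 | q <- trep (Q' y)] | y <- r]) => U Ue Ur UD UM s.
have U0 : U 0 by rewrite -(rmorph0 e); apply: Ue.
pose V (y : X') := exists t : seq (L' * X),
  (forall q, q \in t -> U q.2) /\ y = Q (tcls l e t).
have V0 : V 0.
  by exists [::]; split=> //; rewrite tcls_sum big_nil rmorph0.
have VD y z : V y -> V z -> V (y + z).
  move=> [t [Ut ->]] [t' [Ut' ->]]; exists (t ++ t'); split.
    by move=> q; rewrite mem_cat => /orP[/Ut|/Ut'].
  by rewrite !tcls_sum big_cat rmorphD.
have VM y z : V y -> V z -> V (y * z).
  move=> [t [Ut ->]] [t' [Ut' ->]]; rewrite -rmorphM !tcls_sum mulr_suml rmorph_sum.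
  rewrite big_seq; elim/big_ind: _ => // -[a b] /Ut Ub.
  rewrite mulr_sumr rmorph_sum big_seq; elim/big_ind: _ => // -[a' b'] /Ut' Ub'.
  exists [:: (a * a', b * b')]; split; last by rewrite tcls_sum big_seq1 tensM.
  by move=> q; rewrite inE => /eqP->; apply: UM.
have [||t [Ut E]] := rP V _ _ VD VM (p s).
- move=> a; exists [:: (a, 1)]; split; last first.
    by rewrite tcls_sum big_seq1 QE [RHS](tlift_inl C).
  by move=> q; rewrite inE => /eqP-> /=; rewrite -(rmorph1 e); apply: Ue.
- move=> y yr; exists (trep (Q' y)); split=> [q qy|]; last by rewrite trepK Q'K.
  apply: Ur; apply/flattenP; exists [seq q.2 | q <- trep (Q' y)]; last exact: map_f.
  exact: map_f.
have sE : tinr l e s = tcls l e t.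
  by apply: (can_inj QK); rewrite -E QE (tlift_inr C).
rewrite -(tevl_inr e s psiP psi1) sE tcls_sum tevl_sum // big_seq.
elim/big_ind: _ => // -[a b] /Ut Ub /=; rewrite tevlE //; exact: UM (Ue _) Ub.
Qed.

Lemma torsor_descent : is_torsor X' -> is_torsor X.
Proof.
move=> tX'; have [X1 fX' _] := tX'; split.
- by move=> E; apply: X1; rewrite -(rmorph1 p) E rmorph0.
- exact: finite_type_descent.
- by move=> R h; apply: simply_transitive_descent.
Qed.
End TorsorDescent.

(** * The inverse limit *)

Section System.
Context {F : diffFieldType} (Y : diffFactSystem F).

Lemma fs_glue (x : forall i, fs_fld Y i) :
  (forall k, fs_pl Y k (x (inl (fs_l Y k))) = x (inr k)) ->
  (forall k, fs_pr Y k (x (inl (fs_r Y k))) = x (inr k)) ->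
  exists a, forall i, fs_in Y i a = x i.
Proof.
move=> xl xr; have [f _ fK] := fs_lim Y.
pose z : invlim (R := fun i => fs_fld Y i : diffRingType) (fs_pl Y) (fs_pr Y) :=
  @InvLim _ _ _ _ (fun i => fs_fld Y i : diffRingType) (fs_pl Y) (fs_pr Y) x xl xr.
by exists (f z) => i; have := congr1 (fun t => lproj t i) (fK z).
Qed.

(** Without vertices there are no edges either, and the limit of the empty system is the zero ring,
    which is not a field. *)
Lemma fs_nonempty : exists i : fsV Y, true.
Proof.
apply: contrapT => V0; have no (i : fsV Y) : False by apply: V0; exists i.
have : (0 : F) = 1.
  apply: (bij_inj (fs_lim Y)); apply: invlim_eq => -[i|k]; first by case: (no i).
  by case: (no (fs_l Y k)).
by move/eqP; rewrite eq_sym oner_eq0.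
Qed.

(* A union of components would give an idempotent of the limit F, a field. *)
Lemma fs_connected (T : eqType) (d : fsV Y -> T) :
  (forall k, d (fs_l Y k) = d (fs_r Y k)) -> forall i j, d i = d j.
Proof.
move=> dlr i j.
pose D (q : fsV Y + fsE Y) :=
  match q with inl q => d q == d j | inr k => d (fs_l Y k) == d j end.
have [k|k|a aE] := @fs_glue (fun q => (D q)%:R).
- by rewrite rmorph_nat.
- by rewrite rmorph_nat /= dlr.
have a1 : a = 1.
  apply: (fmorph_inj (fs_in Y (inl j))).
  by rewrite [LHS]aE /= eqxx (rmorph1 (fs_in Y (inl j))).
have := aE (inl i); rewrite a1 rmorph1 /=; case: eqP => // _ /eqP.
by rewrite oner_eq0.
Qed.
End System.

(** * Gluing the coefficient spaces *)

Section Patch.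
Context {F : diffFieldType} {Y : diffFactSystem F} {G : linAlgGroup (constants F)}
  (P : patching Y G).
Local Notation S := (pp_lim P).

Lemma pp_proj_zmod i : zmod_morphism (pp_proj (P := P) i). Proof. by []. Qed.
Lemma pp_proj_monoid i : monoid_morphism (pp_proj (P := P) i). Proof. by []. Qed.
Lemma pp_proj_der i s : pp_proj (P := P) i (der s) = der (pp_proj i s).
Proof. by []. Qed.
HB.instance Definition _ i :=
  GRing.isZmodMorphism.Build S (pp_obj P i) (pp_proj (P := P) i) (pp_proj_zmod i).
HB.instance Definition _ i :=
  GRing.isMonoidMorphism.Build S (pp_obj P i) (pp_proj (P := P) i) (pp_proj_monoid i).
HB.instance Definition _ i :=
  isDiffMorphism.Build S (pp_obj P i) (pp_proj (P := P) i) (@pp_proj_der i).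

Lemma pp_proj_alg i a : pp_proj i (pp_lim_alg P a) = dga_alg (pp_obj P i) (fs_in Y i a).
Proof. by []. Qed.

Lemma pp_proj_l k s : bc_mor (pp_thl P k) (pp_proj (inl (fs_l Y k)) s) = pp_proj (inr k) s.
Proof. exact: lproj_l. Qed.
Lemma pp_proj_r k s : bc_mor (pp_thr P k) (pp_proj (inl (fs_r Y k)) s) = pp_proj (inr k) s.
Proof. exact: lproj_r. Qed.

(** The index set is finite, so the supports of all components of finitely many elements still lie
    in one finite-dimensional W. *)
Lemma pp_support (r : seq S) : exists n (w : 'I_n -> grp_ring G),
  lin_indep (grp_alg G) w /\
  forall s i, s \in r -> coef_in w (pp_proj i s).
Proof.
have [t tP] := choice (fun q : (fsV Y + fsE Y) * S => coef_in_support (pp_proj q.1 q.2)).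
have [n [w [fw wP]]] := seq_basis (grp_alg G)
  (flatten [seq t (i, s) | i <- enum {: fsV Y + fsE Y}, s <- r]).
exists n, w; split=> // s i sr; apply: (tP (i, s)) => c ct; apply: wP.
apply/flattenP; exists (t (i, s)) => //.
by apply: (allpairs_f (fun i s => t (i, s))); rewrite ?mem_enum.
Qed.

Section CommonBasis.
Context {n : nat} {w : 'I_n -> grp_ring G} (fw : lin_indep (grp_alg G) w).

(** The bases at l_k and r_k both map to bases of S_k(W), so the dimensions there agree;
    connectedness makes the dimension constant, as a single matrix size requires. *)
Lemma pp_bases : exists d (b : forall i : fsV Y, 'I_d -> pp_obj P (inl i)),
  forall i, is_basis (dga_alg (pp_obj P (inl i))) (coef_in w) (b i).
Proof.
have H (i : fsV Y) : exists m, exists b : 'I_m -> pp_obj P (inl i),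
    is_basis (dga_alg (pp_obj P (inl i))) (coef_in w) b.
  have [m [c cP]] := coef_in_finite w (pp_torsor P (inl i)).
  exact: subspace_basis (coef_in_subspace _ w) cP.
have [m mP] := choice H; have [i0 _] := fs_nonempty Y.
have mE i : m i = m i0.
  apply: (@fs_connected _ Y) => k.
  have [b1 /(coef_in_mor_basis (pp_thl P k) fw) B1] := mP (fs_l Y k).
  have [b2 /(coef_in_mor_basis (pp_thr P k) fw) B2] := mP (fs_r Y k).
  exact: basis_size B1 B2.
exists (m i0).
have {}mP i : exists b : 'I_(m i0) -> pp_obj P (inl i),
    is_basis (dga_alg (pp_obj P (inl i))) (coef_in w) b.
  by rewrite -(mE i); apply: mP.
by exists (fun i => projT1 (cid (mP i))) => i; case: (cid (mP i)).
Qed.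

Lemma pp_common_basis : simult_fact Y -> exists d (c : 'I_d -> S),
  forall i, is_basis (dga_alg (pp_obj P i)) (coef_in w) (pp_proj i \o c).
Proof.
move=> fact; have [d [b bP]] := pp_bases; exists d.
have bl k := coef_in_mor_basis (pp_thl P k) fw (bP (fs_l Y k)).
have br k := coef_in_mor_basis (pp_thr P k) fw (bP (fs_r Y k)).
(* In S_k the right basis is A_k times the left one. If A_k = B_r^-1 B_l, then B_r b_r = B_r A_k b_l
   = B_l b_l, so replacing each b_i by B_i b_i makes the bases agree. *)
pose A k := s2val (cid2 (basis_change (bl k) (br k))).
have uA k : A k \in unitmx by rewrite /A; case: cid2.
have AE k i : bc_mor (pp_thr P k) (b (fs_r Y k) i) =
    \sum_j dga_alg (pp_obj P (inr k)) (A k i j) * bc_mor (pp_thl P k) (b (fs_l Y k) j).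
  by rewrite /A; case: cid2 => M _ /= /(_ i).
have [B [uB BE]] : exists B : forall i : fsV Y, 'M[fs_fld Y (inl i)]_d,
      (forall i, B i \in unitmx) /\
      forall k, A k = invmx (map_mx (fs_pr Y k) (B (fs_r Y k)))
                      *m map_mx (fs_pl Y k) (B (fs_l Y k)).
  (* Factorization is assumed for positive sizes only; in size 0 all matrices are equal. *)
  have [d0|d0] := posnP d; last exact: fact.
  exists (fun=> 1%:M); split=> [i|k]; first exact: unitmx1.
  by apply/matrixP => -[i ilt]; exfalso; rewrite d0 in ilt.
pose cV (i : fsV Y) p := \sum_q dga_alg (pp_obj P (inl i)) (B i p q) * b i q.
(* The component at k is defined through l_k, so compatibility on that side is immediate and the one
   through r_k carries the content. *)
pose c p i : pp_obj P i := match i with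
  | inl i => cV i p | inr k => bc_mor (pp_thl P k) (cV (fs_l Y k) p) end.
have cl p k : pp_ml P k (c p (inl (fs_l Y k))) = c p (inr k) by [].
have clE p k : bc_mor (pp_thl P k) (cV (fs_l Y k) p) =
    \sum_q dga_alg (pp_obj P (inr k)) (map_mx (fs_pl Y k) (B (fs_l Y k)) p q) *
      bc_mor (pp_thl P k) (b (fs_l Y k) q).
  rewrite rmorph_sum; apply: eq_bigr => q _.
  by rewrite mxE; apply: bc_mor_scale.
have crE p k : bc_mor (pp_thr P k) (cV (fs_r Y k) p) =
    \sum_q dga_alg (pp_obj P (inr k)) (map_mx (fs_pr Y k) (B (fs_r Y k)) p q) *
      bc_mor (pp_thr P k) (b (fs_r Y k) q).
  rewrite rmorph_sum; apply: eq_bigr => q _.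
  by rewrite mxE; apply: bc_mor_scale.
have cr p k : pp_mr P k (c p (inl (fs_r Y k))) = c p (inr k).
  rewrite [LHS]crE [RHS]clE; under eq_bigr => q _ do rewrite AE.
  rewrite sum_mulmx BE mulKVmx //.
  by rewrite map_unitmx; apply: uB.
exists (fun p => InvLim (cl p) (cr p)) => -[i|k].
  exact: basis_mulmx (coef_in_subspace _ w) (uB i) (bP i).
apply: (coef_in_mor_basis (pp_thl P k) fw).
exact: basis_mulmx (coef_in_subspace _ w) (uB _) (bP _).
Qed.

Context {d : nat} {c : 'I_d -> S}.
Hypothesis cP : forall i, is_basis (dga_alg (pp_obj P i)) (coef_in w) (pp_proj i \o c).

(** The transition maps send the basis at a vertex to the basis at k, so uniqueness of coordinates
    over F_k makes the coordinates of [s] compatible; they glue to elements of F. *)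
Lemma pp_lim_span s : (forall i, coef_in w (pp_proj i s)) -> inspan (pp_lim_alg P) c s.
Proof.
move=> ws.
have H i : exists x : 'I_d -> fs_fld Y i, pp_proj i s =
    \sum_j dga_alg (pp_obj P i) (x j) * pp_proj i (c j).
  by have [_ _ sc] := cP i; apply: sc (ws i).
pose x i := projT1 (cid (H i)).
have xE i : pp_proj i s = \sum_j dga_alg (pp_obj P i) (x i j) * pp_proj i (c j).
  by rewrite /x; case: (cid (H i)).
have glue j : exists a, forall i, fs_in Y i a = x i j.
  apply: fs_glue => k.
    have [_ fc _] := cP (inr k); apply: (free_coef fc (x := fs_pl Y k \o x _)).
    rewrite -[RHS]xE -[RHS]pp_proj_l xE rmorph_sum.
    by apply: eq_bigr => q _; rewrite [RHS]bc_mor_scale pp_proj_l.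
  have [_ fc _] := cP (inr k); apply: (free_coef fc (x := fs_pr Y k \o x _)).
  rewrite -[RHS]xE -[RHS]pp_proj_r xE rmorph_sum.
  by apply: eq_bigr => q _; rewrite [RHS]bc_mor_scale pp_proj_r.
have [a aE] := choice glue; exists a; apply: invlim_eq => i.
rewrite -[LHS]/(pp_proj i s) -[RHS]/(pp_proj i _) xE rmorph_sum.
by apply: eq_bigr => j _; rewrite rmorphM -aE.
Qed.
End CommonBasis.

(** Each element involves only one W. A tensor in the kernel is rewritten over a common basis for
    its right components, and independence in S_i kills its coefficients; an element of S_i lies in
    some S_i(W), which has a basis coming from S. *)
Lemma pp_phi_bij i : simult_fact Y ->
  bijective (tlift (dga_alg (pp_obj P i)) (pp_proj i) :
             tensor (fs_in Y i) (pp_lim_alg P) -> pp_obj P i).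
Proof.
move=> fact; have [Q QE] := tlift_rmorph (fun a => esym (pp_proj_alg i a)).
apply: (eq_bij (f := Q)) => //; apply: inj_surj_bij => [|y].
  apply: raddf_inj => z Qz0.
  have [n [w [fw wP]]] := pp_support [seq q.2 | q <- trep z].
  have [d [c cP]] := pp_common_basis fw fact.
  have [|a zE] := @tens_span_r _ _ _ (fs_in Y i) (pp_lim_alg P) z _ c.
    by move=> q qz; apply: (pp_lim_span cP) => i'; apply: wP; apply: map_f.
  have [_ fc _] := cP i; rewrite zE big1 // => j _.
  suff -> : a j = 0 by rewrite tens0l.
  apply: fc; rewrite -[RHS]Qz0 zE raddf_sum; apply: eq_bigr => q _.
  by rewrite [RHS]QE (tliftE (fun a => esym (pp_proj_alg i a))).
have [r rP] := coef_in_support y; have [n [w [fw wP]]] := seq_basis (grp_alg G) r.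
have [d [c cP]] := pp_common_basis fw fact; have [_ _ sc] := cP i.
have [x ->] := sc _ (rP n w wP).
exists (\sum_j tens (fs_in Y i) (pp_lim_alg P) (x j) (c j)).
rewrite rmorph_sum; apply: eq_bigr => q _.
by rewrite QE (tliftE (fun a => esym (pp_proj_alg i a))).
Qed.
End Patch.

(** * Isomorphisms of torsors induced by semilinear equivariant maps *)

Section IsoOfMor.
Context {K : fieldType} {G : linAlgGroup K} {L L' : diffFieldType}
  {k : {dmorphism triv K -> L}} {k' : {dmorphism triv K -> L'}}
  {l : {dmorphism L -> L'}} (lk : forall c, l (k c) = k' c)
  {X : diffGAlg G k} {X' : diffGAlg G k'} (p : {dmorphism X -> X'}).
Hypothesis p_alg : forall a, p (dga_alg X a) = dga_alg X' (l a).
Hypothesis p_coact : forall s, coact X' (p s) = tmap p (gmap l) (coact X s).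
Hypothesis p_bij :
  bijective (tlift (dga_alg X') p : tensor l (dga_alg X) -> X').

(** Converse to the passage from [th] to [bc_mor]. Equivariance equates two homomorphisms on L'
    (x)_L X, so it is checked on the two factors. *)
Lemma iso_of_mor : exists th : diffGIso (base_change lk X) X',
  forall z, th z = tlift (dga_alg X') p z.
Proof.
have C a : dga_alg X' (l a) = p (dga_alg X a) by rewrite p_alg.
pose Q : {dmorphism base_change lk X -> X'} := tlift_dmorph C.
have Ql a : Q (dga_alg (base_change lk X) a) = dga_alg X' a := tlift_inl C a.
have Qr s : Q (tinr l (dga_alg X) s) = p s := tlift_inr C s.
have CH a : (tinl (dga_alg X') (galg G k') \o Q) (tinl l (dga_alg X) a) =
           (tinr (dga_alg X') (galg G k') \o idfun) (galg G k' a).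
  exact: etrans (congr1 (tinl _ _) (Ql a)) (tinlr _ _ _).
have [H HE] := tlift_rmorph CH.
have [m [mE ml mr]] := cmap_rmorph (G := G) lk p_alg.
have E1 : H \o tlift_dmorph (bc_compat1 lk X) =1 m.
  apply: tens_eq_hom => [a|c].
    rewrite ml; apply: etrans (congr1 H (tlift_inl (bc_compat1 lk X) a)) _.
    apply: etrans (HE _) _; apply: etrans (tlift_inl CH _) _.
    by congr (tinl _ _ _); apply: Qr.
  rewrite mr; apply: etrans (congr1 H (tlift_inr (bc_compat1 lk X) c)) _.
  by apply: etrans (HE _) _; apply: (tlift_inr CH).
have E2 : coact X' \o Q =1 H \o bc_coact lk X.
  apply: tens_eq_hom => [a|s].
    apply: etrans (congr1 (coact X') (Ql a)) _; rewrite (coact_alg (coactP X')).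
    apply/esym; apply: etrans (congr1 H (tlift_inl (bc_compat2 lk X) a)) _.
    apply: etrans (HE _) _; apply: etrans (tlift_inl CH _) _.
    by congr (tinl _ _ _); apply: Ql.
  apply: etrans (congr1 (coact X') (Qr s)) _.
  apply/esym; apply: etrans (congr1 H (tlift_inr (bc_compat2 lk X) s)) _.
  by apply: etrans (E1 _) _; rewrite p_coact mE.
have Q_coact z : coact X' (Q z) = tmap Q idfun (coact (base_change lk X) z).
  apply: etrans (E2 z) _; exact: HE.
by exists (DiffGIso Ql Q_coact p_bij).
Qed.
End IsoOfMor.

Section IsoTensor.
Context {K : fieldType} {G : linAlgGroup K} {L L' : diffFieldType}
  {k : {dmorphism triv K -> L}} {k' : {dmorphism triv K -> L'}}
  {l : {dmorphism L -> L'}} {lk : forall c, l (k c) = k' c}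
  {X : diffGAlg G k} {X' : diffGAlg G k'}.
Variable th : diffGIso (base_change lk X) X'.

Lemma bc_mor_tlift z : th z = tlift (dga_alg X') (bc_mor th) z.
Proof.
rewrite [in LHS](tens_repE z) rmorph_sum; apply: eq_bigr => q _.
exact: bc_mor_tens.
Qed.

Lemma iso_tmap (L0 : Type) (S : comPzRingType) (f : L0 -> L') (e : L0 -> S)
    (q : S -> X) (z : tensor f e) :
  th (tmap idfun q z) = tlift (dga_alg X') (bc_mor th \o q) z.
Proof.
apply: etrans (tlift_nat th _ _ _) _; congr (tlift _ _ _).
by apply/funext => a; apply: (iso_alg th).
Qed.
End IsoTensor.

(** * The co-action on the limit *)

Section Coaction.
Context {F : diffFieldType} {Y : diffFactSystem F} {G : linAlgGroup (constants F)}
  (P : patching Y G).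
Local Notation S := (pp_lim P).
Local Notation k0 := (@const_incl F).
Local Notation T := (tensor (pp_lim_alg P) (galg G k0)).
Local Notation M i := (tmap (pp_proj (P := P) i) (pp_gmap i) :
  T -> tensor (dga_alg (pp_obj P i)) (galg G (fs_const i))).

Lemma pp_lim_eq (s t : S) :
  (forall i : fsV Y, pp_proj (inl i) s = pp_proj (inl i) t) -> s = t.
Proof.
move=> st; apply: invlim_eq => -[i|k]; first exact: st.
by rewrite -[LHS]pp_proj_l -[RHS]pp_proj_l st.
Qed.

(** A tensor is determined by its coefficients in S, and these by their components at the
    vertices. *)
Lemma pp_cmap_inj (t t' : T) :
  (forall i : fsV Y, M (inl i) t = M (inl i) t') -> t = t'.
Proof.
move=> E; apply: coef_eq => phi phiP; apply: pp_lim_eq => i.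
have C := ev_cmap (@fs_const_in _ Y (inl i)) (@pp_proj_alg _ _ _ P (inl i)).
by rewrite -!C // [X in ev phi X]E.
Qed.

Lemma pp_cmap_dmorph i :
  {h : {dmorphism T -> tensor (dga_alg (pp_obj P i)) (galg G (fs_const i))} |
   h =1 M i}.
Proof.
have C a : (tinl (dga_alg (pp_obj P i)) (galg G (fs_const i)) \o pp_proj i) (pp_lim_alg P a) =
  (tinr (dga_alg (pp_obj P i)) (galg G (fs_const i)) \o
    gmap_dmorph G (@fs_const_in _ Y i)) (galg G k0 a).
  apply: etrans (tinlr _ (galg G (fs_const i)) (fs_in Y i a)) _.
  congr (tinr _ _ _).
  exact/esym/(tlift_inl (gmap_compat G (@fs_const_in _ Y i))).
by exists (tlift_dmorph C).
Qed.

(** For W containing the supports of all components of [s], the coefficients along a basis of W are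
    compatible families because [bc_mor] commutes with taking coefficients; they are therefore
    elements of S. *)
Lemma pp_coact_exists (s : S) :
  exists t : T, forall i, coact (pp_obj P i) (pp_proj i s) = M i t.
Proof.
have [n [w [fw wP]]] := pp_support [:: s].
have [phi [phiP dual]] := free_dual fw.
pose u j i : pp_obj P i := ev (phi j) (coact (pp_obj P i) (pp_proj i s)).
have ul j k : pp_ml P k (u j (inl (fs_l Y k))) = u j (inr k).
  by rewrite /u -pp_proj_l ev_bc_mor.
have ur j k : pp_mr P k (u j (inl (fs_r Y k))) = u j (inr k).
  by rewrite /u -pp_proj_r ev_bc_mor.
exists (\sum_j tinl _ _ (InvLim (ul j) (ur j) : S) * gel _ (w j)) => i.
have lk := @fs_const_in _ Y i.
apply: coef_eq => psi psiP; rewrite (ev_cmap lk (@pp_proj_alg _ _ _ P i)) // ev_comb //.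
have /(coef_inE _ phiP dual) -> // := wP s i (mem_head _ _).
rewrite rmorph_sum; apply: eq_bigr => j _.
by rewrite rmorphM -lk.
Qed.

Lemma pp_coact : exists rho : {dmorphism S -> T},
  (forall a, rho (pp_lim_alg P a) = tinl _ _ (pp_lim_alg P a)) /\
  forall i s, coact (pp_obj P i) (pp_proj i s) = M i (rho s).
Proof.
(* By [pp_cmap_inj] the chosen values are the only possible ones, so additivity, multiplicativity
   and compatibility with the derivation are inherited from the vertices. *)
have [rho rhoE] := choice pp_coact_exists.
have rho_zmod : zmod_morphism rho.
  move=> s t; apply: pp_cmap_inj => i; have [h hE] := pp_cmap_dmorph (inl i).
  rewrite -rhoE -[RHS]hE !rmorphB.
  by congr (_ - _); rewrite [RHS]hE; apply: rhoE.
have rho_monoid : monoid_morphism rho.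
  split=> [|s t]; apply: pp_cmap_inj => i; have [h hE] := pp_cmap_dmorph (inl i).
    by rewrite -rhoE -[RHS]hE !rmorph1.
  rewrite -rhoE -[RHS]hE !rmorphM.
  by congr (_ * _); rewrite [RHS]hE; apply: rhoE.
have rho_der s : rho (der s) = der (rho s).
  apply: pp_cmap_inj => i; have [h hE] := pp_cmap_dmorph (inl i).
  rewrite -rhoE -[RHS]hE !dmorph_der.
  by congr (der _); rewrite [RHS]hE; apply: rhoE.
pose rhod : {dmorphism S -> T} := HB.pack rho
  (GRing.isZmodMorphism.Build _ _ _ rho_zmod)
  (GRing.isMonoidMorphism.Build _ _ _ rho_monoid)
  (isDiffMorphism.Build _ _ _ rho_der).
exists rhod; split=> [a|i s]; last exact: rhoE.
apply: pp_cmap_inj => i; rewrite -rhoE pp_proj_alg (coact_alg (coactP _)).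
by have [h [<- -> _]] :=
  cmap_rmorph (G := G) (@fs_const_in _ Y (inl i)) (@pp_proj_alg _ _ _ P (inl i)).
Qed.
End Coaction.

(** The last hypothesis identifies L' (x) alpha with a composite of bijections. Injectivity
    restricts along A -> L' (x)_L A; a preimage over L' is contracted to a preimage over L. *)
Lemma bij_descent (L L' : fieldType) (l : {rmorphism L -> L'})
    (A B Z : comPzRingType) (e : {rmorphism L -> A}) (e' : {rmorphism L -> B})
    (alpha : {rmorphism A -> B})
    (Q : {rmorphism tensor l e -> Z}) (Q' : {rmorphism tensor l e' -> Z}) :
  (forall a, alpha (e a) = e' a) -> bijective Q -> bijective Q' ->
  (forall a s, Q (tens l e a s) = Q' (tens l e' a (alpha s))) -> bijective alpha.
Proof.
move=> alphaE [R QK RK] [R' QK' RK'] QQ'.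
have L1 : (1 : L') <> 0 by apply/eqP/oner_neq0.
have [psi psiP psi1] := linfunc_one l L1.
apply: inj_surj_bij => [x y xy|y].
  apply: (tinr_inj psiP psi1 (g := e)); apply: (can_inj QK).
  by rewrite !QQ' xy.
pose z := R (Q' (tinr l e' y)).
have yE : tinr l e' y = \sum_(q <- trep z) tens l e' q.1 (alpha q.2).
  apply: (can_inj QK'); rewrite -[LHS]RK -/z [in LHS](tens_repE z) !rmorph_sum.
  by apply: eq_bigr => q _; apply: QQ'.
exists (\sum_(q <- trep z) e (psi q.1) * q.2).
rewrite -(tevl_inr e' y psiP psi1) yE tevl_sum // rmorph_sum.
by apply: eq_bigr => q _; rewrite tevlE // rmorphM alphaE.
Qed.

(** * Uniqueness of the solution *)

Section Uniqueness.
Context {F : diffFieldType} {Y : diffFactSystem F} {G : linAlgGroup (constants F)}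
  {P : patching Y G}.

(** The two maps on F_k (x)_F X agree on F_k by construction, so only their values on 1 (x) s
    matter. In this form the condition says that the maps X -> S_i form a cone. *)
Lemma solution_compat (X : diffGAlg G (@const_incl F))
    (Phi : forall i : fsV Y, diffGIso (extend (inl i) X) (pp_obj P (inl i))) :
  is_solution Phi <-> is_torsor X /\
    forall k s, bc_mor (pp_thl P k) (bc_mor (Phi (fs_l Y k)) s) =
                bc_mor (pp_thr P k) (bc_mor (Phi (fs_r Y k)) s).
Proof.
split=> -[tX H]; split=> // k s.
  have := H k (tinr _ _ s).
  rewrite /= [LHS]iso_tmap [RHS]iso_tmap.
  have Cl a : dga_alg (pp_obj P (inr k)) (fs_in Y (inr k) a) =
      (bc_mor (pp_thl P k) \o bc_mor (Phi (fs_l Y k))) (dga_alg X a).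
    rewrite -fs_inl; apply: etrans (esym (bc_mor_alg (pp_thl P k) _)) _.
    exact/esym/(congr1 (bc_mor _))/(bc_mor_alg (Phi _)).
  have Cr a : dga_alg (pp_obj P (inr k)) (fs_in Y (inr k) a) =
      (bc_mor (pp_thr P k) \o bc_mor (Phi (fs_r Y k))) (dga_alg X a).
    rewrite -fs_inr; apply: etrans (esym (bc_mor_alg (pp_thr P k) _)) _.
    exact/esym/(congr1 (bc_mor _))/(bc_mor_alg (Phi _)).
  by move=> E; apply: etrans (esym (tlift_inr Cl s)) (etrans E (tlift_inr Cr s)).
rewrite /= [LHS]iso_tmap [RHS]iso_tmap; congr (tlift _ _ _).
by apply/funext => x; apply: H.
Qed.

Variables (rho : {dmorphism pp_lim P -> tensor (pp_lim_alg P) (galg G (@const_incl F))})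
  (rhoP : is_coaction rho).
Let S := DiffGAlg rhoP.
Hypothesis rhoE : forall i s,
  coact (pp_obj P i) (pp_proj i s) = tmap (pp_proj (P := P) i) (pp_gmap i) (rho s).
Variables (Phi : forall i : fsV Y, diffGIso (extend (inl i) S) (pp_obj P (inl i))).
Hypothesis PhiE : forall i z, Phi i z = tlift (dga_alg (pp_obj P (inl i))) (pp_proj (inl i)) z.

Let Phi_tens i a s : Phi i (tens _ _ a s) = dga_alg (pp_obj P (inl i)) a * pp_proj (inl i) s.
Proof. by rewrite PhiE; apply: (tliftE (fun b => esym (@pp_proj_alg _ _ _ P (inl i) b))). Qed.

Lemma solution_unique (S' : diffGAlg G (@const_incl F))
    (Phi' : forall i : fsV Y, diffGIso (extend (inl i) S') (pp_obj P (inl i))) :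
  is_solution Phi' -> exists alpha : diffGIso S' S,
    forall i x, Phi' i x = Phi i (tmap idfun alpha x).
Proof.
move=> /solution_compat[tS' H].
(* At k the map is taken through l_k; compatibility through r_k is then exactly the solution
   condition [H], and the universal property of the limit yields [alpha]. *)
pose u i : {dmorphism S' -> pp_obj P i} := match i with
  | inl i => bc_mor (Phi' i)
  | inr k => bc_mor (pp_thl P k) \o bc_mor (Phi' (fs_l Y k)) end.
have ul k s : pp_ml P k (u (inl (fs_l Y k)) s) = u (inr k) s by [].
have ur k s : pp_mr P k (u (inl (fs_r Y k)) s) = u (inr k) s by apply/esym/H.
pose alpha : {dmorphism S' -> S} := lim_map ul ur.
have projE i s : pp_proj i (alpha s) = u i s by [].
have alphaE a : alpha (dga_alg S' a) = dga_alg S a.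
  by apply: pp_lim_eq => i; rewrite projE [LHS]bc_mor_alg.
have alpha_coact s : coact S (alpha s) = tmap alpha idfun (coact S' s).
  have C a : (tinl (dga_alg S) (galg G (@const_incl F)) \o alpha) (dga_alg S' a) =
      (tinr (dga_alg S) (galg G (@const_incl F)) \o idfun) (galg G (@const_incl F) a).
    exact: etrans (congr1 (tinl _ _) (alphaE a)) (tinlr _ _ _).
  have [h hE] := tlift_rmorph C.
  apply: pp_cmap_inj => i; rewrite -rhoE projE [LHS](bc_mor_coact (Phi' i)).
  have C1 := bc_mor_alg (Phi' i).
  have C2 := @pp_proj_alg _ _ _ P (inl i).
  have [h1 [h1E h1l h1r]] := cmap_rmorph (G := G) (@fs_const_in _ Y (inl i)) C1.
  have [h2 [h2E h2l h2r]] := cmap_rmorph (G := G) (@fs_const_in _ Y (inl i)) C2.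
  have E : h1 =1 h2 \o h.
    apply: tens_eq_hom => [a|c].
      rewrite h1l /= hE (tlift_inl C) [RHS]h2l; congr (tinl _ _ _).
    by rewrite h1r /= hE (tlift_inr C) [RHS]h2r.
  by rewrite -[LHS]h1E -[RHS]h2E E /= hE.
have [i0 _] := fs_nonempty Y.
(* One vertex suffices: over F_i0, [alpha] becomes the comparison of the isomorphisms [Phi' i0] and
   [Phi i0]. *)
have alpha_bij : bijective alpha.
  apply: (bij_descent (l := fs_in Y (inl i0)) (Q := Phi' i0) (Q' := Phi i0) alphaE).
  - exact: (iso_bij (Phi' i0)).
  - exact: (iso_bij (Phi i0)).
  - by move=> a s; rewrite [RHS]Phi_tens [LHS]bc_mor_tens.
exists (DiffGIso alphaE alpha_coact alpha_bij) => i x.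
rewrite [LHS]bc_mor_tlift [RHS]iso_tmap; congr (tlift _ _ _).
apply/funext => s; rewrite /= [RHS]Phi_tens rmorph1 mul1r.
exact: projE.
Qed.
End Uniqueness.

Theorem theorem2p2 (F : diffFieldType) (Y : diffFactSystem F)
    (G : linAlgGroup (constants F)) (P : patching Y G) :
  simult_fact Y ->
  exists (rho : {dmorphism pp_lim P ->
                   tensor (pp_lim_alg P) (galg G (@const_incl F))})
         (rhoP : is_coaction rho),
    let S := DiffGAlg rhoP in
    (forall i (s : S),
       coact (pp_obj P i) (pp_proj i s) =
       tmap (pp_proj (P := P) i) (pp_gmap i) (coact S s)) /\
    exists Phi : forall i : fsV Y,
        diffGIso (extend (inl i) S) (pp_obj P (inl i)),
      [/\ forall i a s,
            Phi i (tens _ _ a s) =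
            (dga_alg (pp_obj P (inl i)) a * pp_proj (inl i) s)%R,
          is_solution Phi &
          forall (S' : diffGAlg G (@const_incl F))
            (Phi' : forall i : fsV Y,
               diffGIso (extend (inl i) S') (pp_obj P (inl i))),
            is_solution Phi' ->
            exists alpha : diffGIso S' S,
              forall i x, Phi' i x = Phi i (tmap idfun alpha x)].
Proof.
move=> fact; have [rho [rho_alg rhoE]] := pp_coact P.
(* Both the co-action axioms and the torsor property on S descend from the single field F_i0,
   whichever vertex is chosen. *)
have [i0 _] := fs_nonempty Y.
have proj_alg := @pp_proj_alg _ _ _ P.
have rhoP : is_coaction rho.
  exact: (coaction_descent (@fs_const_in _ Y (inl i0)) rho_alg (proj_alg (inl i0))
    (rhoE (inl i0)) (pp_phi_bij P _ fact)).
exists rho, rhoP => S; split; first exact: rhoE.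
have iso (i : fsV Y) : exists th : diffGIso (extend (inl i) S) (pp_obj P (inl i)),
    forall z, th z = tlift (dga_alg (pp_obj P (inl i))) (pp_proj (inl i)) z.
  exact: (iso_of_mor (X := S) (@fs_const_in _ Y (inl i)) (proj_alg (inl i))
    (rhoE (inl i)) (pp_phi_bij P _ fact)).
pose Phi i := projT1 (cid (iso i)).
have PhiE i z : Phi i z = tlift (dga_alg (pp_obj P (inl i))) (pp_proj (inl i)) z.
  by rewrite /Phi; case: cid.
have PhiT i a s : Phi i (tens _ _ a s) =
    dga_alg (pp_obj P (inl i)) a * pp_proj (inl i) s.
  by rewrite PhiE; apply: (tliftE (fun b => esym (@pp_proj_alg _ _ _ P (inl i) b))).
exists Phi; split=> //.
  apply/solution_compat; split=> [|k s].
    exact: (torsor_descent (X := S) (@fs_const_in _ Y (inl i0)) (proj_alg (inl i0))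
      (rhoE (inl i0)) (pp_phi_bij P _ fact) (pp_torsor P (inl i0))).
  have PhiR i : bc_mor (Phi i) s = pp_proj (inl i) s.
    by rewrite [LHS]PhiT rmorph1 mul1r.
  by rewrite !PhiR pp_proj_l pp_proj_r.
by move=> S' Phi'; apply: (solution_unique rhoE PhiE).
Qed.
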